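(* Let $f\colon \mathrm{iSt}_{A,J}(p,n)\to\mathbb{R}$ be a smooth function and let $\bar f\colon\mathcal{E}\to\mathbb{R}$ be a smooth extension of $f$. Let $X\in \mathrm{iSt}_{A,J}(p,n)$ and $\xi\in T_X\mathrm{iSt}_{A,J}(p,n)$. For $i\in\{1,2\}$ let $\mathrm{Hess}^{(i)} f$ denote the Riemannian Hessian of $f$ with respect to the metric on $\mathrm{iSt}_{A,J}(p,n)$ induced by $G^{(i)}$. Put $M_X:=(X^\top X)^{-1}$, $\Pi_X:=I_n-XM_XX^\top$, $S_X:=A-AXJX^\top A$. For $\zeta\in T_X\mathrm{iSt}_{A,J}(p,n)$ put $\Omega_{X,\zeta}:=X^\top A\zeta\in\mathrm{Skew}(p)$. For $\eta\in T_X\mathrm{iSt}_{A,J}(p,n)$ put $$B_{X,\xi,\eta}:=\xi X^\top A\eta+\eta X^\top A\xi,$$ $$C_{X,\xi,\eta}:=\mathrm{sym}(A\,\mathrm{sym}(XJ\xi^\top)AS_X)\eta+\mathrm{sym}(A\,\mathrm{sym}(XJ\eta^\top)AS_X)\xi-\mathrm{sym}(AS_X\,\mathrm{sym}(\xi\eta^\top)A)XJ,$$ $$D_{X,\xi,\eta}:=XM_X\,\mathrm{sym}(\xi^\top\eta)+\xi\,\mathrm{skew}(M_XX^\top\eta)+\eta\,\mathrm{skew}(M_XX^\top\xi).$$ For $i\in\{1,2\}$ put $$\eta^{(i)}:=\mathrm{grad}^{G^{(i)}}f(X)=(G_X^{(i)})^{-1}\mathrm{grad}_{\mathrm E}\bar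 f(X)-XJ\,\mathrm{sym}\big(X^\top A(G_X^{(i)})^{-1}\mathrm{grad}_{\mathrm E}\bar f(X)\big),$$ and let $P_X^{G^{(i)}}(Y)=Y-XJ\,\mathrm{sym}(X^\top AY)$, $Y\in\mathbb{R}^{n\times p}$, be the orthogonal projection onto $T_X\mathrm{iSt}_{A,J}(p,n)$. Then $$\begin{aligned}\mathrm{Hess}^{(1)}f(X)[\xi]={}&A^{-1}\Pi_X\big(\rho^{-1}B_{X,\xi,\eta^{(1)}}-2A^{-1}C_{X,\xi,\eta^{(1)}}\big)\\&+P_X^{G^{(1)}}\Big(2X\big(-\rho X^\top C_{X,\xi,\eta^{(1)}}+\mathrm{sym}(\Omega_{X,\xi}\Omega_{X,\eta^{(1)}})\big)\\&\quad-(G_X^{(1)})^{-1}\,\mathrm{D}G^{(1)}(X)[\xi]\,(G_X^{(1)})^{-1}\mathrm{grad}_{\mathrm E}\bar f(X)+(G_X^{(1)})^{-1}\mathrm{Hess}_{\mathrm E}\bar f(X)[\xi]\\&\quad-\rho\,\xi J\,\mathrm{sym}(JX^\top\mathrm{grad}_{\mathrm E}\bar f(X))\Big)\end{aligned}$$ and $$\begin{aligned}\mathrm{Hess}^{(2)}f(X)[\xi]={}&A^{-1}S_X\big(\rho^{-1}S_XB_{X,\xi,\eta^{(2)}}-D_{X,\xi,\eta^{(2)}}+AXJ\,\mathrm{sym}(\xi^\top\Pi_X\eta^{(2)})\big)\\&+P_X^{G^{(2)}}\Big(X\big(-\rho\,\mathrm{sym}(\xi^\top\Pi_X\eta^{(2)})+2\,\mathrm{sym}(\Omega_{X,\xi}\Omega_{X,\eta^{(2)}})\big)\\&\quad-(G_X^{(2)})^{-1}\,\mathrm{D}G^{(2)}(X)[\xi]\,(G_X^{(2)})^{-1}\mathrm{grad}_{\mathrm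 E}\bar f(X)+(G_X^{(2)})^{-1}\mathrm{Hess}_{\mathrm E}\bar f(X)[\xi]\\&\quad-\rho\,\xi J\,\mathrm{sym}(JX^\top\mathrm{grad}_{\mathrm E}\bar f(X))\Big).\end{aligned}$$
   Context: Standing setting: $p\le n$ are positive integers; $A$ is a real symmetric invertible $n\times n$ matrix; $J$ is a real symmetric $p\times p$ matrix with $J^2=I_p$, whose numbers of positive and negative eigenvalues are at most those of $A$, respectively; $\rho>0$ is a real parameter. For a square matrix $S$, $\mathrm{sym}(S)=(S+S^\top)/2$ and $\mathrm{skew}(S)=(S-S^\top)/2$. $\mathrm{Skew}(p)$ is the set of real skew-symmetric $p\times p$ matrices. $\mathcal{E}$ is the open subset (open submanifold) of $\mathbb{R}^{n\times p}$ consisting of all $X$ with $\det(X^\top X)\ne0$ and $\det(X^\top AX)\neq 0$; its tangent space at each point is $\mathbb{R}^{n\times p}$. The indefinite Stiefel manifold is $\mathrm{iSt}_{A,J}(p,n)=\{X\in\mathbb{R}^{n\times p}\mid X^\top AX=J\}$, an embedded submanifold of $\mathcal{E}$, with tangent space $T_X\mathrm{iSt}_{A,J}(p,n)=\{\xi\in\mathbb{R}^{n\times p}\mid \xi^\top AX+X^\top A\xi=0\}$. For $X\in\mathcal{E}$, define $G_X^{(1)}=\frac1\rho AXX^\top A+(A-AXJX^\top A)^2$ and $G_X^{(2)}=\frac1\rho AXX^\top A+I_n-X(X^\top X)^{-1}X^\top$; both are symmetric positive definite. The map $G^{(i)}\colon X\mapsto G_X^{(i)}$ on $\mathcal{E}$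 has derivative $\mathrm{D}G^{(i)}(X)[\xi]$ at $X$ in direction $\xi$. The Riemannian metric associated with $G^{(i)}$ is $\langle\xi,\eta\rangle_X=\mathrm{tr}(\xi^\top G_X^{(i)}\eta)$ on $\mathcal{E}$, and $\mathrm{iSt}_{A,J}(p,n)$ carries the induced metric (Riemannian submanifold). $\mathrm{grad}^{G^{(i)}}f$ is the Riemannian gradient of $f$ on $\mathrm{iSt}_{A,J}(p,n)$ for this metric, and the Riemannian Hessian is $\mathrm{Hess}^{(i)}f(X)[\xi]=\nabla_\xi\,\mathrm{grad}^{G^{(i)}}f$ with $\nabla$ the Levi-Civita connection of this metric on $\mathrm{iSt}_{A,J}(p,n)$. $\mathrm{grad}_{\mathrm E}\bar f$ is the Euclidean gradient (with respect to the inner product $\mathrm{tr}(Y^\top Z)$ on $\mathbb{R}^{n\times p}$), and $\mathrm{Hess}_{\mathrm E}\bar f(X)[\xi]=\mathrm{D}(\mathrm{grad}_{\mathrm E}\bar f)(X)[\xi]$. *)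

(* Defs.v *)
From HB Require Import structures.
From mathcomp Require Import all_boot all_order all_algebra.
From mathcomp Require Import all_classical all_reals all_analysis.
From mathcomp.real_closed Require polyrcf.

Set Implicit Arguments.
Unset Strict Implicit.
Unset Printing Implicit Defensive.

Import Order.TTheory GRing.Theory Num.Theory.
Import numFieldNormedType.Exports.

Local Open Scope classical_set_scope.
Local Open Scope ring_scope.

(* Only used on finite-dimensional spaces, where it is the usual class C^k. *)
Fixpoint Ck_on (R : realType) (V W : normedModType R) (k : nat) (U : set V)
    (F : V -> W) : Prop :=
  if k is k'.+1 then
    (forall x, U x -> differentiable F x) /\
    (forall v : V, Ck_on k' U ('D_v F))
  else forall x, U x -> {for x, continuous F}.

Definition smooth_on (R : realType) (V W : normedModType R) (U : set V)
    (F : V -> W) : Prop := forall k, Ck_on k U F.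

(* Maps on a subset [M] (an embedded submanifold of [V] in what follows) are
   represented by total functions on [V], whose values outside [M] are
   irrelevant.  In the definitions below [T x] is the tangent space of [M] at
   [x] and [g x] is the inner product on [T x]. *)

Definition smooth_map (R : realType) (V W : normedModType R) (M : set V)
    (F : V -> W) : Prop :=
  forall x, M x -> exists (U : set V) (Fext : V -> W),
    [/\ open U, U x, smooth_on U Fext
      & forall y, M y -> U y -> Fext y = F y].

Definition curve_through (R : realType) (V : normedModType R) (M : set V)
    (x u : V) (c : R -> V) : Prop :=
  [/\ c 0 = x, is_derive (0 : R) 1 c u & \forall t \near (0 : R), M (c t)].

(* The differential D f (x)[u] = (f o c)'(0) of a function on [M]; for [f]
   smooth it does not depend on the curve [c] in [M] chosen by [get]. *)
Definition mder (R : realType) (V : normedModType R) (M : set V) (f : V -> R)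
    (x u : V) : R :=
  'D_1 (f \o get (curve_through M x u)) (0 : R).

Definition vector_field (R : realType) (V : normedModType R) (M : set V)
    (T : V -> set V) (F : V -> V) : Prop :=
  smooth_map M F /\ forall x, M x -> T x (F x).

(* [nabla x u F] is the covariant derivative at [x] of the field [F] in the
   direction [u]. *)
Record is_connection (R : realType) (V : normedModType R) (M : set V)
    (T : V -> set V) (nabla : V -> V -> (V -> V) -> V) : Prop := {
  conn_ext : forall x u F F', M x -> T x u ->
    vector_field M T F -> vector_field M T F' ->
    (forall y, M y -> F y = F' y) -> nabla x u F = nabla x u F' ;
  conn_tangent : forall x u F, M x -> T x u -> vector_field M T F ->
    T x (nabla x u F) ;
  conn_smooth : forall F H, vector_field M T F -> vector_field M T H ->
    smooth_map M (fun x => nabla x (F x) H) ;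
  conn_linear_dir : forall x u w (a b : R) F, M x -> T x u -> T x w ->
    vector_field M T F ->
    nabla x (a *: u + b *: w) F = a *: nabla x u F + b *: nabla x w F ;
  conn_linear_field : forall x u (a b : R) F H, M x -> T x u ->
    vector_field M T F -> vector_field M T H ->
    nabla x u (fun y => a *: F y + b *: H y) =
      a *: nabla x u F + b *: nabla x u H ;
  conn_leibniz : forall x u (f : V -> R) F, M x -> T x u ->
    smooth_map M f -> vector_field M T F ->
    nabla x u (fun y => f y *: F y) =
      mder M f x u *: F x + f x *: nabla x u F }.

(* In the torsion-freeness clause, the right-hand side is the derivation
   [F, H] f = F (H f) - H (F f) evaluated at [x]. *)
Record is_levi_civita (R : realType) (V : normedModType R) (M : set V)
    (T : V -> set V) (g : V -> V -> V -> R)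
    (nabla : V -> V -> (V -> V) -> V) : Prop := {
  lc_connection : is_connection M T nabla ;
  lc_torsion_free : forall x F H (f : V -> R), M x ->
    vector_field M T F -> vector_field M T H -> smooth_map M f ->
    mder M f x (nabla x (F x) H - nabla x (H x) F) =
      mder M (fun y => mder M f y (H y)) x (F x)
      - mder M (fun y => mder M f y (F y)) x (H x) ;
  lc_metric : forall x u F H, M x -> T x u ->
    vector_field M T F -> vector_field M T H ->
    mder M (fun y => g y (F y) (H y)) x u =
      g x (nabla x u F) (H x) + g x (F x) (nabla x u H) }.

Definition rgrad (R : realType) (V : normedModType R) (M : set V)
    (T : V -> set V) (g : V -> V -> V -> R) (f : V -> R) (x : V) : V :=
  get [set v | T x v /\ forall z, T x z -> g x v z = mder M f x z].

Definition rhess (R : realType) (V : normedModType R) (M : set V)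
    (T : V -> set V) (g : V -> V -> V -> R)
    (nabla : V -> V -> (V -> V) -> V) (f : V -> R) (x u : V) : V :=
  nabla x u (rgrad M T g f).

Definition is_orth_proj (R : realType) (V : normedModType R) (S : set V)
    (g : V -> V -> R) (P : V -> V) : Prop :=
  forall y, S (P y) /\ forall z, S z -> g (y - P y) z = 0.

Definition egrad (R : realType) (n p : nat) (f : 'M[R]_(n, p) -> R)
    (X : 'M[R]_(n, p)) : 'M[R]_(n, p) :=
  get [set v | forall Z, \tr (v^T *m Z) = 'D_Z f X].

Definition ehess (R : realType) (n p : nat) (f : 'M[R]_(n, p) -> R)
    (X xi : 'M[R]_(n, p)) : 'M[R]_(n, p) :=
  'D_xi (egrad f) X.

(* Eigenvalues counted with multiplicity; a real symmetric matrix has only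
   real eigenvalues. *)
Definition npos_eig (R : realType) (n : nat) (A : 'M[R]_n) : nat :=
  (\sum_(a <- polyrcf.rootsR (char_poly A) | (0 < a)%R) mup a (char_poly A))%N.

Definition nneg_eig (R : realType) (n : nat) (A : 'M[R]_n) : nat :=
  (\sum_(a <- polyrcf.rootsR (char_poly A) | (a < 0)%R) mup a (char_poly A))%N.

Definition sym (R : realType) (n : nat) (S : 'M[R]_n) : 'M[R]_n :=
  2^-1 *: (S + S^T).

Definition skew (R : realType) (n : nat) (S : 'M[R]_n) : 'M[R]_n :=
  2^-1 *: (S - S^T).

Definition Skew (R : realType) (p : nat) : set 'M[R]_p :=
  [set S | S^T = - S].

Section IndefiniteStiefel.
Context (R : realType) (n p : nat) (A : 'M[R]_n) (J : 'M[R]_p) (rho : R).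
Implicit Types X xi eta zeta Y : 'M[R]_(n, p).

Definition ambient : set 'M[R]_(n, p) :=
  [set X | \det (X^T *m X) <> 0 /\ \det (X^T *m A *m X) <> 0].

Definition iSt : set 'M[R]_(n, p) := [set X | X^T *m A *m X = J].

Definition tangent X : set 'M[R]_(n, p) :=
  [set xi | xi^T *m A *m X + X^T *m A *m xi = 0].

Definition gram_inv X : 'M[R]_p := invmx (X^T *m X).

Definition Pi_mx X : 'M[R]_n := 1%:M - X *m gram_inv X *m X^T.

Definition S_mx X : 'M[R]_n := A - A *m X *m J *m X^T *m A.

Definition G1 X : 'M[R]_n :=
  rho^-1 *: (A *m X *m X^T *m A) + S_mx X *m S_mx X.

Definition G2 X : 'M[R]_n :=
  rho^-1 *: (A *m X *m X^T *m A) + Pi_mx X.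

Definition metric (G : 'M[R]_(n, p) -> 'M[R]_n) X xi eta : R :=
  \tr (xi^T *m G X *m eta).

Definition Omega_mx X zeta : 'M[R]_p := X^T *m A *m zeta.

Definition B_mx X xi eta : 'M[R]_(n, p) :=
  xi *m X^T *m A *m eta + eta *m X^T *m A *m xi.

Definition C_mx X xi eta : 'M[R]_(n, p) :=
  sym (A *m sym (X *m J *m xi^T) *m A *m S_mx X) *m eta
  + sym (A *m sym (X *m J *m eta^T) *m A *m S_mx X) *m xi
  - sym (A *m S_mx X *m sym (xi *m eta^T) *m A) *m X *m J.

Definition D_mx X xi eta : 'M[R]_(n, p) :=
  X *m gram_inv X *m sym (xi^T *m eta)
  + xi *m skew (gram_inv X *m X^T *m eta)
  + eta *m skew (gram_inv X *m X^T *m xi).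

Definition proj_tan X Y : 'M[R]_(n, p) := Y - X *m J *m sym (X^T *m A *m Y).

End IndefiniteStiefel.

Arguments ambient {R n} p A.

(* Main.v *)
Require Import Defs.
From HB Require Import structures.
From mathcomp Require Import all_boot all_order all_algebra.
From mathcomp Require Import all_classical all_reals all_analysis.
From mathcomp Require Import perm ring lra.

Set Implicit Arguments.
Unset Strict Implicit.
Unset Printing Implicit Defensive.

Import Order.TTheory GRing.Theory Num.Theory.
Import numFieldNormedType.Exports.

Local Open Scope classical_set_scope.
Local Open Scope ring_scope.

(** For a metric given by a matrix field [G] on an open set of matrices, the
    Levi-Civita connection of a submanifold is the orthogonal projection of
    a flat derivative plus a Christoffel term. So the Hessian, the covariant
    derivative of the gradient, is obtained from three ingredients.

    First, the Koszul formula. A connection that satisfies the axioms is not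
    assumed to come from the ambient space. But each difference between its
    covariant derivative and the flat derivative of an extension is symmetric
    ([lc_symmetric], from torsion-freeness applied to the coordinate functions)
    and is linked to the derivative of [G] by compatibility with the metric
    ([lc_compatible]); the usual alternating sum then determines its tangential
    part ([koszul]). This needs curves through each point with each tangent
    velocity, so that derivatives of functions on the manifold are derivatives
    of their extensions ([mderE]), and vector fields through each tangent
    vector. The curves are given by Cayley transforms ([curve_iSt]), the fields
    by projections of constant matrices ([tangent_field]).

    Second, the gradient. If [G X *m X = rho^-1 *: (A *m X *m J)] on the
    manifold, which holds for both metrics, then the matrices [X *m J *m s] with
    [s] symmetric are orthogonal to the tangent space ([orth_proj_tan]), and the
    gradient is the projection of [invmx (G X)] times the Euclidean gradient
    ([rgradE]). The same formula defines a smooth extension of the gradient near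
    the manifold, whose derivative is computed in [proj_derive_grad_ext].

    Third, matrix algebra. The Koszul terms are represented by a matrix
    ([lower_christoffel1P], [lower_christoffel2P]), to which the explicit inverse
    of [G X] is applied ([G1_inv], [G2_inv]). The outcome splits into a normal
    part, which the projection kills, a tangent part, which it fixes, and a rest
    that stays under the projection ([invmx_G1_christoffel],
    [invmx_G2_christoffel]); [rhess_decomp] puts the pieces together. *)

(** * Differentiation of matrix-valued maps *)

Section MatrixDiff.
Context (R : realType) (V : normedModType R).

Lemma is_diff_ext (W : normedModType R) (F F' dF dF' : V -> W) x :
  F =1 F' -> dF =1 dF' -> is_diff x F dF -> is_diff x F' dF'.
Proof. by move=> /funext<- /funext<-. Qed.

(** Two computations of one differential agree; [is_diff_invmx] uses this to
    solve an equation for an unknown differential. *)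
Lemma is_diff_unique (W : normedModType R) (F dF dF' : V -> W) x :
  is_diff x F dF -> is_diff x F dF' -> dF =1 dF'.
Proof. by move=> [_ <-] [_ <-]. Qed.

Lemma is_diff_differentiable (W : normedModType R) (F dF : V -> W) x :
  is_diff x F dF -> differentiable F x.
Proof. by case. Qed.

Lemma is_diff_derive (W : normedModType R) (F dF : V -> W) x v :
  is_diff x F dF -> 'D_v F x = dF v.
Proof. by move=> [dFx <-]; exact: deriveE. Qed.

Lemma is_diff_add (W : normedModType R) (F G dF dG : V -> W) x :
  is_diff x F dF -> is_diff x G dG ->
  is_diff x (fun y => F y + G y) (fun v => dF v + dG v).
Proof. by move=> dFx dGx; exact: is_diffD. Qed.

Lemma is_diff_scale (W : normedModType R) (a : R) (F dF : V -> W) x :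
  is_diff x F dF -> is_diff x (fun y => a *: F y) (fun v => a *: dF v).
Proof. by move=> dFx; exact: is_diffZ. Qed.

Lemma is_diff_cstB (W : normedModType R) (w : W) (F dF : V -> W) x :
  is_diff x F dF -> is_diff x (fun y => w - F y) (fun v => - dF v).
Proof.
move=> dFx; apply: is_diff_ext (is_diffB (is_diff_cst w x) dFx) => // v.
exact: sub0r.
Qed.

Lemma is_diff_linear (W1 W2 : normedModType R) (L : {linear W1 -> W2})
    (F dF : V -> W1) x :
  continuous L -> is_diff x F dF -> is_diff x (fun y => L (F y)) (fun v => L (dF v)).
Proof.
move=> Lc dFx; apply: (@is_diff_comp _ _ _ _ F dF L L x dFx).
by apply: DiffDef; [exact: linear_differentiable|rewrite diff_lin].
Qed.

Lemma is_diff_sum (W : normedModType R) (I : Type) (r : seq I) (F dF : I -> V -> W) x :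
  (forall i, is_diff x (F i) (dF i)) ->
  is_diff x (fun y => \sum_(i <- r) F i y) (fun v => \sum_(i <- r) dF i v).
Proof.
move=> dFi; elim: r => [|i r IH].
  by apply: (is_diff_ext _ _ (is_diff_cst 0 x)) => y; rewrite big_nil.
by apply: (is_diff_ext _ _ (is_diffD (dFi i) IH)) => y; rewrite big_cons.
Qed.

Lemma is_diff_entry m q (F dF : V -> 'M[R]_(m, q)) x i j :
  is_diff x F dF -> is_diff x (fun y => F y i j) (fun v => dF v i j).
Proof.
move=> dFx; apply: (@is_diff_comp _ _ _ _ F dF (fun N : 'M[R]_(m, q) => N i j) (fun N : 'M[R]_(m, q) => N i j) x dFx).
have @f : {linear 'M[R]_(m, q) -> R}.
  by exists (fun N : 'M[R]_(_, _) => N i j); do 2![eexists]; do ?[constructor];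
     rewrite ?mxE// => ? *; rewrite ?mxE//; move=> ?; rewrite !mxE.
have fc : continuous f by exact: coord_continuous.
apply: DiffDef; first exact: differentiable_coord.
by rewrite (_ : (fun _ => _) = f) //; rewrite (diff_lin _ fc).
Qed.

Lemma is_diff_mx m q (F dF : V -> 'M[R]_(m, q)) x :
  (forall i j, is_diff x (fun y => F y i j) (fun v => dF v i j)) ->
  is_diff x F dF.
Proof.
move=> dFx.
apply: (@is_diff_ext _ (fun y => \sum_i \sum_j F y i j *: delta_mx i j) _
    (fun y => \sum_i \sum_j dF y i j *: delta_mx i j)) => [y|y|].
- by rewrite -matrix_sum_delta.
- by rewrite -matrix_sum_delta.
apply: is_diff_sum => i; apply: is_diff_sum => j.
apply: DiffDef; first exact/differentiableZl/ex_diff.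
by rewrite diffZl ?diff_val//; exact: ex_diff.
Qed.

Lemma is_diff_mulmx m q r (F dF : V -> 'M[R]_(m, q)) (G dG : V -> 'M[R]_(q, r)) x :
  is_diff x F dF -> is_diff x G dG ->
  is_diff x (fun y => F y *m G y) (fun v => dF v *m G x + F x *m dG v).
Proof.
move=> dFx dGx; apply: is_diff_mx => i j.
apply: (@is_diff_ext _ (fun y => \sum_k F y i k * G y k j) _
    (fun v => \sum_k (F x i k * dG v k j + G x k j * dF v i k))) => [y|v|].
- by rewrite mxE.
- rewrite !mxE big_split/= addrC; congr (_ + _).
  by apply: eq_bigr => k _; rewrite mulrC.
apply: is_diff_sum => k.
exact: is_diffM (is_diff_entry i k dFx) (is_diff_entry k j dGx).
Qed.

Lemma is_diff_mulmxl m q r (B : 'M[R]_(m, q)) (F dF : V -> 'M[R]_(q, r)) x :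
  is_diff x F dF -> is_diff x (fun y => B *m F y) (fun v => B *m dF v).
Proof.
move=> dFx; apply: is_diff_ext (is_diff_mulmx (is_diff_cst B x) dFx) => // v.
by rewrite /cst -[X in X + _]/(0 *m F x) mul0mx add0r.
Qed.

Lemma is_diff_mulmxr m q r (F dF : V -> 'M[R]_(m, q)) (B : 'M[R]_(q, r)) x :
  is_diff x F dF -> is_diff x (fun y => F y *m B) (fun v => dF v *m B).
Proof.
move=> dFx; apply: is_diff_ext (is_diff_mulmx dFx (is_diff_cst B x)) => // v.
by rewrite /cst -[X in _ + X]/(F x *m 0) mulmx0 addr0.
Qed.

Lemma is_diff_trmx m q (F dF : V -> 'M[R]_(m, q)) x :
  is_diff x F dF -> is_diff x (fun y => (F y)^T) (fun v => (dF v)^T).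
Proof.
move=> dFx; apply: is_diff_mx => i j.
by apply: is_diff_ext (is_diff_entry j i dFx) => y; rewrite mxE.
Qed.

Lemma is_diff_mxtrace m (F dF : V -> 'M[R]_m) x :
  is_diff x F dF -> is_diff x (fun y => \tr (F y)) (fun v => \tr (dF v)).
Proof.
move=> dFx.
exact: (is_diff_sum _ (fun i => is_diff_entry i i dFx)).
Qed.

Lemma differentiable_det m (F : V -> 'M[R]_m) x :
  (forall i j, differentiable (fun y => F y i j) x) -> differentiable (fun y => \det (F y)) x.
Proof.
move=> dFx.
suff H : forall s : 'S_m, differentiable (fun y => (-1) ^+ s * \prod_i F y i (s i)) x.
  exact: (is_diff_differentiable (is_diff_sum _ (fun s => differentiableP (H s)))).
move=> s; apply: (@differentiableZ _ _ _ (fun y => \prod_i F y i (s i))).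
elim: (index_enum _) => [|i r IH].
  rewrite (_ : (fun y => _) = cst 1); last by apply/funext => y; rewrite big_nil.
  exact: differentiable_cst.
rewrite (_ : (fun y => _) = (fun y => F y i (s i)) * (fun y => \prod_(j <- r) F y j (s j))).
  exact: differentiableM.
by apply/funext => y; rewrite big_cons.
Qed.

Lemma is_diff_near (W : normedModType R) (F G dF : V -> W) x :
  (\forall y \near x, F y = G y) -> is_diff x F dF -> is_diff x G dF.
Proof.
move=> FG [/diff_locallyP[dFc dFo] <-].
have FGx : F x = G x by exact: nbhs_singleton FG.
have dGo : G \o shift x = cst (G x) + 'd F x +o_ 0 id.
  apply/eqaddoP => e e0; move/eqaddoP : dFo => /(_ e e0).
  apply: filter_app.
  have : \forall y \near 0, F (y + x) = G (y + x).
    by move: FG; rewrite (near_shift 0) subr0; apply.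
  apply: filter_app; near=> y => yFG.
  by rewrite /= -FGx -[X in X -> _]/(is_true (`|(F (y + x) - _)| <= _)) yFG.
have dGE := diff_unique dFc dGo.
have dG : differentiable G x by apply/diff_locallyP; rewrite dGE; split.
by apply: DiffDef; [exact: dG|exact: dGE].
Unshelve. all: by end_near. Qed.

Lemma near_unitmx m (F : V -> 'M[R]_m) x : {for x, continuous (fun y => \det (F y))} ->
  F x \in unitmx -> \forall y \near x, F y \in unitmx.
Proof.
rewrite unitmxE unitfE => dc F0.
near=> y; rewrite unitmxE unitfE; near: y.
exact: (cvgr_neq0 _ dc F0).
Unshelve. all: by end_near. Qed.

(** Cramer's rule: near a point where the determinant does not vanish, the
    entries of the inverse are quotients of polynomials in the entries. *)
Lemma differentiable_invmx m (F : V -> 'M[R]_m) x :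
  differentiable F x -> F x \in unitmx -> differentiable (fun y => invmx (F y)) x.
Proof.
move=> dF uF.
have dFij k l : differentiable (fun y => F y k l) x.
  exact: (is_diff_differentiable (is_diff_entry k l (differentiableP dF))).
have ddet := differentiable_det dFij.
have det0 : \det (F x) != 0 by rewrite -unitfE -unitmxE.
have near_unit := near_unitmx (differentiable_continuous ddet) uF.
have dentry i j : differentiable (fun y => (\det (F y))^-1 * \adj (F y) i j) x.
  apply: differentiableM; first exact: differentiableV.
  rewrite (_ : (fun y => _) = fun y => (-1) ^+ (j + i) * \det (row' j (col' i (F y)))); last first.
    by apply/funext => y; rewrite mxE.
  apply: (@differentiableZ _ _ _ (fun y => \det (row' j (col' i (F y))))).
  apply: differentiable_det => k l.
  have -> : (fun y => row' j (col' i (F y)) k l) = (fun y => F y (lift j k) (lift i l)).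
    by apply/funext => y; rewrite !mxE.
  exact: dFij.
pose inv y := (\det (F y))^-1 *: \adj (F y).
pose dinv v := \matrix_(i, j) 'd (fun y => (\det (F y))^-1 * \adj (F y) i j) x v.
have is_inv : is_diff x inv dinv.
  apply: is_diff_mx => i j.
  apply: is_diff_ext (differentiableP (dentry i j)) => y; first by rewrite /inv [RHS]mxE.
  by rewrite /dinv mxE.
apply: (is_diff_differentiable (is_diff_near _ is_inv)).
by apply: filter_app near_unit; near=> y => uy; rewrite /invmx uy.
Unshelve. all: by end_near. Qed.

(** Differentiating [F y *m invmx (F y) = 1%:M], which holds near [x], gives an
    equation that determines the differential of the inverse. *)
Lemma is_diff_invmx m (F dF : V -> 'M[R]_m) x :
  is_diff x F dF -> F x \in unitmx ->
  is_diff x (fun y => invmx (F y)) (fun v => - (invmx (F x) *m dF v *m invmx (F x))).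
Proof.
move=> dFx uF.
have dinv := differentiable_invmx (is_diff_differentiable (dFx)) uF.
apply: DiffDef; first exact: dinv.
apply/funext => v.
have prod_diff := is_diff_mulmx dFx (differentiableP dinv).
have dFij k l : differentiable (fun y => F y k l) x.
  exact: (is_diff_differentiable (is_diff_entry k l dFx)).
have near_unit := near_unitmx (differentiable_continuous (differentiable_det dFij)) uF.
have prod_cst : is_diff x (cst 1%:M) (fun v => dF v *m invmx (F x) + F x *m 'd (fun y => invmx (F y)) x v).
  apply: is_diff_near prod_diff.
  by apply: filter_app near_unit; near=> y => uy; rewrite mulmxV.
have := is_diff_unique (is_diff_cst 1%:M x) prod_cst v.
move=> /(congr1 (fun h => invmx (F x) *m h)).
rewrite mulmx0 mulmxDr !mulmxA mulVmx// mul1mx => /esym/eqP.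
by rewrite addrC addr_eq0 => /eqP.
Unshelve. all: by end_near. Qed.

End MatrixDiff.

(** * Smooth maps on an open set *)

Section Smooth.
Context (R : realType) (V : normedModType R) (U : set V).
Hypothesis Uo : open U.
Implicit Types (W : normedModType R).

Lemma Ck_on_eq W k (F G : V -> W) : (forall x, U x -> F x = G x) ->
  Ck_on k U F -> Ck_on k U G.
Proof.
have near_eq (F' G' : V -> W) x : (forall y, U y -> F' y = G' y) -> U x ->
    \forall y \near x, F' y = G' y.
  move=> FG Ux; have := open_nbhs_nbhs (conj Uo Ux).
  by apply: filter_app; near=> y => /FG.
elim: k F G => [|k IH] F G FG /=.
  move=> Fc x Ux; rewrite /prop_for /continuous_at -(FG x Ux).
  apply: cvg_trans (Fc x Ux); apply: near_eq_cvg.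
  exact: near_eq.
move=> [dF CF]; split=> [x Ux|v].
  exact: (is_diff_differentiable (is_diff_near (near_eq _ _ _ FG Ux) (differentiableP (dF x Ux)))).
apply: IH (CF v) => x Ux; exact/near_eq_derive/near_eq.
Unshelve. all: by end_near. Qed.

(** At order zero this is the continuity of differentiable maps; higher orders
    follow by induction on directional derivatives. *)
Lemma Ck_onW W k (F : V -> W) : Ck_on k.+1 U F -> Ck_on k U F.
Proof.
elim: k F => [|k IH] F [dF CF].
  by move=> x Ux; exact/differentiable_continuous/dF.
by split=> // v; exact/IH/CF.
Qed.

Lemma smooth_on_sub W (U' : set V) (F : V -> W) :
  U' `<=` U -> smooth_on U F -> smooth_on U' F.
Proof.
move=> sub sF k; elim: k F sF => [|k IH] F sF.
  by move=> x /sub; exact: sF 0 x.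
split=> [x /sub Ux|v]; first by have [dF _] := sF 1; exact: dF.
by apply: IH => l; have [_] := sF l.+1; exact.
Qed.

Lemma smooth_on_differentiable W (F : V -> W) x :
  smooth_on U F -> U x -> differentiable F x.
Proof. by move=> /(_ 1)[dF _] Ux; exact: dF. Qed.

Lemma smooth_on_is_diff W (F : V -> W) x :
  smooth_on U F -> U x -> is_diff x F (fun v => 'D_v F x).
Proof.
move=> sF Ux; have dF := smooth_on_differentiable sF Ux.
by apply: DiffDef => //; apply/funext => v; rewrite deriveE.
Qed.

(** The definition of class C^(k+1) asks every directional derivative to be C^k,
    so no order is lost on smooth maps. *)
Lemma smooth_on_derive W (F : V -> W) v :
  smooth_on U F -> smooth_on U ('D_v F).
Proof. by move=> sF k; have [_] := sF k.+1; exact. Qed.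

Lemma Ck_on_cst W k (w : W) : Ck_on k U (cst w).
Proof.
elim: k w => [|k IH] w /=; first by move=> x _; exact: cvg_cst.
split=> [x _|v]; first exact: differentiable_cst.
by apply: Ck_on_eq (IH 0) => x _; rewrite derive_cst.
Qed.

Lemma smooth_on_cst W (w : W) : smooth_on U (fun=> w).
Proof. by move=> k; exact: Ck_on_cst. Qed.

Lemma smooth_on_id : smooth_on U id.
Proof.
case=> [|k] /=; first by move=> x _; exact: cvg_id.
split=> [x _|v]; first exact: ex_diff.
by apply: Ck_on_eq (Ck_on_cst k v) => x _; rewrite derive_id.
Qed.

Lemma Ck_onD W k (F G : V -> W) : Ck_on k U F -> Ck_on k U G ->
  Ck_on k U (fun y => F y + G y).
Proof.
elim: k F G => [|k IH] F G /=.
  by move=> Fc Gc x Ux; exact: cvgD (Fc x Ux) (Gc x Ux).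
move=> [dF CF] [dG CG]; split=> [x Ux|v].
  by apply: differentiableD; [exact: dF|exact: dG].
apply: Ck_on_eq (IH _ _ (CF v) (CG v)) => x Ux; rewrite deriveD//.
  exact/diff_derivable/dF.
exact/diff_derivable/dG.
Qed.

Lemma smooth_onD W (F G : V -> W) : smooth_on U F -> smooth_on U G ->
  smooth_on U (fun y => F y + G y).
Proof. by move=> sF sG k; exact: Ck_onD. Qed.

Lemma Ck_on_linear W W' k (L : {linear W -> W'}) (F : V -> W) :
  continuous L -> Ck_on k U F -> Ck_on k U (fun y => L (F y)).
Proof.
move=> Lc; elim: k F => [|k IH] F /=.
  by move=> Fc x Ux; apply: continuous_comp; [exact: Fc|exact: Lc].
move=> [dF CF].
have dLF x : U x -> is_diff x (fun y => L (F y)) (fun v => L ('d F x v)).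
  by move=> Ux; exact: is_diff_linear Lc (differentiableP (dF x Ux)).
split=> [x Ux|v]; first exact: (is_diff_differentiable (dLF x Ux)).
apply: Ck_on_eq (IH _ (CF v)) => x Ux.
by rewrite (is_diff_derive v (dLF x Ux)) deriveE//; exact: dF.
Qed.

Lemma smooth_on_linear W W' (L : {linear W -> W'}) (F : V -> W) :
  continuous L -> smooth_on U F -> smooth_on U (fun y => L (F y)).
Proof. by move=> Lc sF k; exact: Ck_on_linear. Qed.

End Smooth.

(** * Smooth matrix-valued maps *)

(** The product is differentiable on pairs of matrices, by the Leibniz rule
    applied to the two projections, hence continuous. *)
Lemma mulmx_continuous (R : realType) m q r :
  continuous (fun z : 'M[R]_(m, q) * 'M[R]_(q, r) => z.1 *m z.2).
Proof.
move=> z; apply: differentiable_continuous.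
apply: is_diff_differentiable.
apply: is_diff_mulmx (is_diff_linear (L := fst) _ (is_diff_id z)) (is_diff_linear (L := snd) _ (is_diff_id z)).
  by move=> [? ?]; exact: cvg_fst.
by move=> [? ?]; exact: cvg_snd.
Qed.

Section SmoothMatrix.
Context (R : realType) (V : normedModType R) (U : set V).
Hypothesis Uo : open U.

Lemma smooth_onZ (W : normedModType R) (a : R) (F : V -> W) :
  smooth_on U F -> smooth_on U (fun y => a *: F y).
Proof.
apply: (smooth_on_linear Uo (L := *:%R a : W -> W)); exact: scaler_continuous.
Qed.

Lemma smooth_onB (W : normedModType R) (F G : V -> W) :
  smooth_on U F -> smooth_on U G -> smooth_on U (fun y => F y - G y).
Proof.
move=> sF sG k.
apply: (@Ck_on_eq _ _ _ Uo _ _ (fun y => F y + (-1) *: G y)) => [y _|].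
  by rewrite scaleN1r.
by apply: (smooth_onD Uo sF); exact: smooth_onZ.
Qed.

(** Induction on [k]: by the Leibniz rule the derivative of a product is a sum of
    products of maps that are one order less regular. *)
Lemma Ck_on_mulmx m q r k (F : V -> 'M[R]_(m, q)) (G : V -> 'M[R]_(q, r)) :
  Ck_on k U F -> Ck_on k U G -> Ck_on k U (fun y => F y *m G y).
Proof.
elim: k F G => [|k IH] F G CF CG.
  move=> x Ux; apply: (@continuous2_cvg V _ _ _ (nbhs x) _ F G (@mulmx _ m q r) (F x) (G x) _ (CF x Ux) (CG x Ux)).
  exact: (@mulmx_continuous _ _ _ _ (F x, G x)).
have [[dF CDF] [dG CDG]] := (CF, CG).
have dFG x : U x -> is_diff x (fun y => F y *m G y)
    (fun v => 'd F x v *m G x + F x *m 'd G x v).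
  by move=> Ux; apply: is_diff_mulmx; apply: differentiableP; [exact: dF|exact: dG].
split=> [x Ux|v]; first exact: (is_diff_differentiable (dFG x Ux)).
apply: (@Ck_on_eq _ _ _ Uo _ _ (fun x => 'D_v F x *m G x + F x *m 'D_v G x)) => [x Ux|].
  by rewrite (is_diff_derive v (dFG x Ux)) (deriveE v (dF x Ux)) (deriveE v (dG x Ux)).
by apply: Ck_onD => //; apply: IH; [exact: CDF|exact: Ck_onW|exact: Ck_onW|exact: CDG].
Qed.

Lemma smooth_on_mulmx m q r (F : V -> 'M[R]_(m, q)) (G : V -> 'M[R]_(q, r)) :
  smooth_on U F -> smooth_on U G -> smooth_on U (fun y => F y *m G y).
Proof. by move=> sF sG k; exact: Ck_on_mulmx. Qed.

Lemma smooth_on_entry m q (F : V -> 'M[R]_(m, q)) i j :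
  smooth_on U F -> smooth_on U (fun y => F y i j).
Proof.
have @f : {linear 'M[R]_(m, q) -> R}.
  by exists (fun N : 'M[R]_(_, _) => N i j); do 2![eexists]; do ?[constructor];
     rewrite ?mxE// => ? *; rewrite ?mxE//; move=> ?; rewrite !mxE.
by apply: (smooth_on_linear Uo (L := f)); exact: coord_continuous.
Qed.

(** A matrix is the sum of its entries times the elementary matrices, and each
    summand is a linear image of an entry. *)
Lemma smooth_on_mx m q (F : V -> 'M[R]_(m, q)) :
  (forall i j, smooth_on U (fun y => F y i j)) -> smooth_on U F.
Proof.
move=> sF k.
apply: (@Ck_on_eq _ _ _ Uo _ _ (fun y => \sum_i \sum_j F y i j *: delta_mx i j)) => [y _|].
  by rewrite -matrix_sum_delta.
have sum_smooth (I : Type) (r : seq I) (H : I -> V -> 'M[R]_(m, q)) :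
    (forall i, smooth_on U (H i)) -> smooth_on U (fun y => \sum_(i <- r) H i y).
  move=> sH; elim: r => [|i r IH] l.
    by apply: Ck_on_eq (Ck_on_cst Uo l 0) => // y _; rewrite big_nil.
  by apply: Ck_on_eq (smooth_onD Uo (sH i) IH l) => // y _; rewrite big_cons.
apply: (sum_smooth) => i; apply: sum_smooth => j.
have sx_lin : linear ( *:%R ^~ (delta_mx i j) : R -> 'M[R]_(m, q)).
  by move=> u y z; rewrite scalerDl scalerA.
pose sxlM := GRing.isLinear.Build _ _ _ _ _ sx_lin.
pose sxL : {linear _ -> _} := HB.pack ( *:%R ^~ (delta_mx i j) : R -> 'M[R]_(m, q)) sxlM.
by apply: (smooth_on_linear Uo (L := sxL)) => //; exact: scalel_continuous.
Qed.

Lemma smooth_on_trmx m q (F : V -> 'M[R]_(m, q)) :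
  smooth_on U F -> smooth_on U (fun y => (F y)^T).
Proof.
move=> sF; apply: smooth_on_mx => i j k.
by apply: Ck_on_eq (smooth_on_entry j i sF k) => // y _; rewrite mxE.
Qed.

(** The order of the inverse is raised step by step while [F] is smooth: its
    derivative is a product of the derivative of [F] with two copies of the
    inverse, which have the order already obtained. *)
Lemma smooth_on_invmx m (F : V -> 'M[R]_m) :
  (forall x, U x -> F x \in unitmx) -> smooth_on U F ->
  smooth_on U (fun y => invmx (F y)).
Proof.
move=> uF sF.
have dinv x : U x -> is_diff x (fun y => invmx (F y))
    (fun v => - (invmx (F x) *m 'D_v F x *m invmx (F x))).
  by move=> Ux; exact: is_diff_invmx (smooth_on_is_diff sF Ux) (uF x Ux).
elim=> [|k IH].
  move=> x Ux; apply: differentiable_continuous.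
  exact: (is_diff_differentiable (dinv x Ux)).
split=> [x Ux|v]; first exact: (is_diff_differentiable (dinv x Ux)).
apply: (@Ck_on_eq _ _ _ Uo _ _ (fun x => (-1) *: (invmx (F x) *m 'D_v F x *m invmx (F x)))) => [x Ux|].
  by rewrite (is_diff_derive v (dinv x Ux)) scaleN1r.
apply: (Ck_on_linear Uo (L := *:%R (-1) : 'M[R]_m -> 'M[R]_m)).
  exact: scaler_continuous.
by apply: Ck_on_mulmx => //; apply: Ck_on_mulmx => //; exact: smooth_on_derive.
Qed.

End SmoothMatrix.

(** * Derivatives along a subset *)

Section Curves.
Context (R : realType) (V : normedModType R) (M : set V).

(** The chain rule along whichever curve the definition of [mder] chooses: the
    result depends on the curve only through its velocity, provided that one
    curve exists. *)
Lemma mderE (F Fext dF : V -> R) x u :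
  (exists c, curve_through M x u c) ->
  (\forall y \near x, M y -> Fext y = F y) -> is_diff x Fext dF ->
  mder M F x u = dF u.
Proof.
move=> exc FextF dFx; rewrite /mder.
have [c0 dc cM] := getPex exc; set c := get _ in c0 dc cM *.
have dfc : differentiable c 0 by apply/derivable1_diffP; exact: ex_derive.
have dc1 : 'd c 0 1 = u by rewrite -deriveE// derive_val.
have dFc : is_diff (c 0) Fext dF by rewrite c0.
have dcomp : is_diff 0 (Fext \o c) (dF \o 'd c 0).
  by apply: is_diff_comp dFc; exact: differentiableP.
have eqc : \forall t \near 0, (Fext \o c) t = (F \o c) t.
  have ccont : c t @[t --> 0] --> x by rewrite -c0; exact: differentiable_continuous.
  by apply: filterS2 cM (ccont _ FextF) => t Mct; exact.
by rewrite -(near_eq_derive _ eqc) (is_diff_derive _ dcomp) /= dc1.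
Qed.

Lemma smooth_map_local (W : normedModType R) (F : V -> W) x :
  smooth_map M F -> M x ->
  exists2 Fext : V -> W, is_diff x Fext (fun v => 'D_v Fext x) &
    \forall y \near x, M y -> Fext y = F y.
Proof.
move=> sF /sF[U [Fext [Uo Ux sFext FextF]]]; exists Fext.
  exact: smooth_on_is_diff sFext Ux.
by apply: filterS (open_nbhs_nbhs (conj Uo Ux)) => y Uy My; exact: FextF.
Qed.

End Curves.

(** * The Koszul formula on an embedded submanifold *)

Section Koszul.
Context (R : realType) (n p : nat).
Local Notation V := 'M[R]_(n, p).
Context (M : set V) (T : V -> set V).
Hypothesis curves : forall x u, M x -> T x u -> exists c, curve_through M x u c.
Hypothesis fields : forall x u, M x -> T x u ->
  exists2 F, vector_field M T F & F x = u.
Hypothesis tangentB : forall x u v, T x u -> T x v -> T x (u - v).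
Context (G : V -> 'M[R]_n) (nabla : V -> V -> (V -> V) -> V).
Hypothesis Gsym : forall x, (G x)^T = G x.
Hypothesis nabla_lc : is_levi_civita M T (metric G) nabla.

Lemma smooth_map_coord i j : smooth_map M (fun y : V => y i j : R).
Proof.
move=> x _; exists setT, (fun y : V => y i j); split=> //; first exact: openT.
by apply: (smooth_on_entry openT (F := id)); exact: smooth_on_id openT.
Qed.

Lemma mder_coord i j x u : M x -> T x u -> mder M (fun y : V => y i j : R) x u = u i j.
Proof.
move=> Mx Tu.
have ext : \forall y \near x, M y -> (y : V) i j = y i j by near=> y.
exact: (mderE (curves Mx Tu) ext (is_diff_entry i j (is_diff_id x))).
Unshelve. all: by end_near. Qed.

(** Torsion-freeness speaks of the action of vector fields on functions. Tested
    on the coordinate functions, it becomes the equality of the two sides entry by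
    entry, because there the bracket of the fields acts as the commutator of the
    directional derivatives of their extensions. *)
Lemma lc_symmetric F H Fe He x : M x ->
  vector_field M T F -> vector_field M T H ->
  is_diff x Fe (fun v => 'D_v Fe x) -> (\forall y \near x, M y -> Fe y = F y) ->
  is_diff x He (fun v => 'D_v He x) -> (\forall y \near x, M y -> He y = H y) ->
  nabla x (F x) H - 'D_(F x) He x = nabla x (H x) F - 'D_(H x) Fe x.
Proof.
move=> Mx vF vH dFe FeF dHe HeH.
suff E : nabla x (F x) H - nabla x (H x) F = 'D_(F x) He x - 'D_(H x) Fe x.
  by apply/eqP; rewrite subr_eq addrAC [_ + 'D_(F x) He x]addrC addrAC -subr_eq E.
apply/matrixP => i j.
have [conn tors _] := nabla_lc.
have TF := vF.2 x Mx; have TH := vH.2 x Mx.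
have coord F' Fe' u : vector_field M T F' -> T x u ->
    is_diff x Fe' (fun v => 'D_v Fe' x) -> (\forall y \near x, M y -> Fe' y = F' y) ->
    mder M (fun y => mder M (fun z : V => z i j : R) y (F' y)) x u = ('D_u Fe' x) i j.
  move=> vF' Tu dFe' Fe'F'.
  apply: (mderE (curves Mx Tu) _ (is_diff_entry i j dFe')).
  by apply: filterS Fe'F' => y + My => ->//; rewrite mder_coord//; exact: vF'.2.
have Tdiff : T x (nabla x (F x) H - nabla x (H x) F).
  by apply: tangentB; apply: (conn_tangent conn).
have e0 := mder_coord i j Mx Tdiff.
have e1 := coord _ _ _ vH TF dHe HeH.
have e2 := coord _ _ _ vF TH dFe FeF.
have e3 := tors x F H (fun y => y i j) Mx vF vH (smooth_map_coord i j).
by rewrite -e0 e3 e1 e2 !mxE.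
Qed.

(** Compatibility with the metric, with the Leibniz expansion of the derivative
    of the inner product moved to the other side: what remains is the error of
    the flat derivative, once for each field. *)
Lemma lc_compatible F H Fe He DG x u : M x -> T x u ->
  vector_field M T F -> vector_field M T H ->
  is_diff x Fe (fun v => 'D_v Fe x) -> (\forall y \near x, M y -> Fe y = F y) ->
  is_diff x He (fun v => 'D_v He x) -> (\forall y \near x, M y -> He y = H y) ->
  is_diff x G DG ->
  \tr ((F x)^T *m DG u *m H x) =
    metric G x (nabla x u F - 'D_u Fe x) (H x) + metric G x (F x) (nabla x u H - 'D_u He x).
Proof.
move=> Mx Tu vF vH dFe FeF dHe HeH dG.
have [_ _ /(_ x u F H Mx Tu vF vH)] := nabla_lc.
have dprod := is_diff_mxtrace (is_diff_mulmx (is_diff_mulmx (is_diff_trmx dFe) dG) dHe).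
rewrite (mderE (curves Mx Tu) _ dprod) => [|]; last first.
  by apply: filterS2 FeF HeH => y FeF HeH My; rewrite /metric FeF// HeH.
have -> : Fe x = F x by apply: (nbhs_singleton FeF).
have -> : He x = H x by apply: (nbhs_singleton HeH).
rewrite /metric [(_ - _)^T]raddfB /= !(mulmxBl, mulmxBr, mulmxDl, mulmxDr).
rewrite !(mxtraceD, raddfB) /=; lra.
Qed.

Lemma metric_sym x u v : metric G x u v = metric G x v u.
Proof. by rewrite /metric -mxtrace_tr !trmx_mul Gsym trmxK mulmxA. Qed.

(** Write [d_u H] for the difference between the covariant and the flat
    derivative. It is symmetric in the two fields by [lc_symmetric], and
    [lc_compatible] gives three relations between the three such differences of
    the fields through [u], [H x] and [z]. Their alternating sum isolates
    [d_u H]. *)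
Lemma koszul H He DG x u z : M x -> T x u -> T x z -> vector_field M T H ->
  is_diff x He (fun v => 'D_v He x) -> (\forall y \near x, M y -> He y = H y) ->
  is_diff x G DG ->
  2 * metric G x (nabla x u H - 'D_u He x) z =
    \tr ((H x)^T *m DG u *m z) + \tr (u^T *m DG (H x) *m z) - \tr (u^T *m DG z *m H x).
Proof.
move=> Mx Tu Tz vH dHe HeH dG.
have [F vF Fx] := fields Mx Tu; have [Z vZ Zx] := fields Mx Tz.
have [Fe dFe FeF] := smooth_map_local vF.1 Mx.
have [Ze dZe ZeZ] := smooth_map_local vZ.1 Mx.
have TH := vH.2 x Mx.
have c1 := lc_compatible Mx Tu vH vZ dHe HeH dZe ZeZ dG.
have c2 := lc_compatible Mx TH vF vZ dFe FeF dZe ZeZ dG.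
have c3 := lc_compatible Mx Tz vF vH dFe FeF dHe HeH dG.
have s1 := lc_symmetric Mx vF vH dFe FeF dHe HeH.
have s2 := lc_symmetric Mx vF vZ dFe FeF dZe ZeZ.
have s3 := lc_symmetric Mx vH vZ dHe HeH dZe ZeZ.
move: c1 c2 c3 s1 s2 s3; rewrite Fx Zx => -> -> -> -> -> ->.
rewrite (metric_sym x (H x)); lra.
Qed.

End Koszul.

(** * Symmetric parts and traces *)

Section Transpose.
Context (R : realType) (m q : nat).
Implicit Types S T : 'M[R]_(m, q).

Lemma trmxD S T : (S + T)^T = S^T + T^T. Proof. exact: raddfD. Qed.
Lemma trmxB S T : (S - T)^T = S^T - T^T. Proof. exact: raddfB. Qed.
Lemma trmxZ a S : (a *: S)^T = a *: S^T. Proof. exact: linearZ. Qed.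

End Transpose.

Section Sym.
Context (R : realType) (m : nat).
Implicit Types S T : 'M[R]_m.

Lemma symD S T : sym (S + T) = sym S + sym T.
Proof. by rewrite /sym trmxD -scalerDr addrACA. Qed.

Lemma symZ a S : sym (a *: S) = a *: sym S.
Proof. by rewrite /sym trmxZ -scalerDr !scalerA mulrC. Qed.

Lemma symN S : sym (- S) = - sym S.
Proof. by rewrite -scaleN1r symZ scaleN1r. Qed.

Lemma is_diff_sym (V : normedModType R) (F dF : V -> 'M[R]_m) x :
  is_diff x F dF -> is_diff x (fun y => sym (F y)) (fun v => sym (dF v)).
Proof. by move=> dFx; apply: is_diffZ; exact: is_diffD dFx (is_diff_trmx dFx). Qed.

Lemma trmx_sym S : (sym S)^T = sym S.
Proof. by rewrite /sym trmxZ trmxD trmxK addrC. Qed.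

Lemma sym_id S : S^T = S -> sym S = S.
Proof. by move=> ST; rewrite /sym ST -mulr2n -(scaler_nat 2 S) scalerA mulVf ?scale1r. Qed.

Lemma sym_skew0 S : S^T = - S -> sym S = 0.
Proof. by move=> ST; rewrite /sym ST subrr scaler0. Qed.

Lemma skew_sub_sym S : Defs.skew S = S - sym S.
Proof.
have e : S = 2^-1 *: (S + S) by rewrite -mulr2n -(scaler_nat 2 S) scalerA mulVf ?scale1r.
by rewrite {2}e /sym /Defs.skew -scalerBr opprD addrACA subrr add0r.
Qed.

(** Transposing and rotating the product shows that the trace is its own
    opposite. *)
Lemma mxtrace_sym_skew S T : S^T = S -> T^T = - T -> \tr (S *m T) = 0.
Proof.
move=> sS sT; have : \tr (S *m T) = - \tr (S *m T).
  by rewrite -{1}mxtrace_tr trmx_mul sS sT mulNmx raddfN/= mxtrace_mulC.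
by move=> ?; lra.
Qed.

End Sym.

Lemma mxtrace_mul_delta (R : realType) n p (v : 'M[R]_(n, p)) i j :
  \tr (v^T *m delta_mx i j) = v i j.
Proof.
rewrite /mxtrace (bigD1 j)//= big1 ?addr0 => [|k kj].
  rewrite mxE (bigD1 i)//= big1 ?addr0 => [|l li].
    by rewrite !mxE !eqxx mulr1.
  by rewrite !mxE (negPf li) mulr0.
rewrite mxE big1// => l _.
by rewrite !mxE (negPf kj) andbF mulr0.
Qed.

Lemma mxtrace_sqr_ge0 (R : realType) n p (v : 'M[R]_(n, p)) : 0 <= \tr (v^T *m v).
Proof.
apply: sumr_ge0 => j _; rewrite mxE; apply: sumr_ge0 => i _.
by rewrite mxE -expr2 sqr_ge0.
Qed.

Lemma mxtrace_sqr_eq0 (R : realType) n p (v : 'M[R]_(n, p)) : \tr (v^T *m v) = 0 -> v = 0.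
Proof.
have ge0 i j : 0 <= v^T j i * v i j by rewrite mxE -expr2 sqr_ge0.
move=> /eqP; rewrite psumr_eq0 => [/allP v0|j _]; last first.
  by rewrite mxE; exact: sumr_ge0.
apply/matrixP => i j; move: (v0 j (mem_index_enum _)); rewrite mxE psumr_eq0// => /allP/(_ i (mem_index_enum _)).
by rewrite mxE -expr2 sqrf_eq0 mxE => /eqP.
Qed.

(** * Tangent spaces and curves of the indefinite Stiefel manifold *)

Section Geometry.
Context (R : realType) (n p : nat) (A : 'M[R]_n) (J : 'M[R]_p).
Hypotheses (A_sym : A^T = A) (J_sym : J^T = J) (J_sqr : J *m J = 1%:M).
Implicit Types X Y : 'M[R]_(n, p).

Lemma tangentP X u : tangent A X u <-> Skew (X^T *m A *m u).
Proof.
rewrite /tangent /Skew /= !trmx_mul trmxK A_sym mulmxA.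
by split=> [/eqP|->]; rewrite ?addNr// addr_eq0 => /eqP.
Qed.

Lemma tangentB X u v : tangent A X u -> tangent A X v -> tangent A X (u - v).
Proof.
move=> /tangentP su /tangentP sv; apply/tangentP.
by rewrite /Skew /= mulmxBr trmxB su sv opprB opprK addrC.
Qed.

Lemma sym_tangent X u : tangent A X u -> sym (X^T *m A *m u) = 0.
Proof. by move=> /tangentP/sym_skew0. Qed.

Lemma proj_tan_id X u : tangent A X u -> proj_tan A J X u = u.
Proof. by move=> /sym_tangent Tu; rewrite /proj_tan Tu mulmx0 subr0. Qed.

Lemma proj_tanD X u v : proj_tan A J X (u + v) = proj_tan A J X u + proj_tan A J X v.
Proof. by rewrite /proj_tan mulmxDr symD mulmxDr opprD addrACA. Qed.

Lemma proj_tanB X u v : proj_tan A J X (u - v) = proj_tan A J X u - proj_tan A J X v.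
Proof.
by rewrite proj_tanD; congr (_ + _); rewrite /proj_tan mulmxN symN mulmxN opprK opprB addrC.
Qed.

Lemma proj_tan_vertical X (s : 'M[R]_p) : iSt A J X -> s^T = s ->
  proj_tan A J X (X *m J *m s) = 0.
Proof.
move=> XJ ss; rewrite /proj_tan !mulmxA XJ J_sqr mul1mx sym_id// subrr//.
Qed.

(** Multiplying the projected matrix by [X^T *m A] subtracts the symmetric part,
    because [J *m J = 1%:M]; a skew-symmetric matrix remains. *)
Lemma tangent_proj X Y : iSt A J X -> tangent A X (proj_tan A J X Y).
Proof.
move=> XJ; apply/tangentP; rewrite /proj_tan mulmxBr !mulmxA XJ J_sqr mul1mx -skew_sub_sym.
by rewrite /Skew /= /Defs.skew trmxZ trmxB trmxK -scalerN opprB.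
Qed.

Lemma smooth_proj_tan (U : set 'M[R]_(n, p)) (F : 'M[R]_(n, p) -> 'M[R]_(n, p)) :
  open U -> smooth_on U F -> smooth_on U (fun y => proj_tan A J y (F y)).
Proof.
move=> Uo sF; have sid := smooth_on_id (V := 'M[R]_(n, p)) Uo.
have scst m q (B : 'M[R]_(m, q)) : smooth_on U (fun=> B) by exact: smooth_on_cst.
have sT := @smooth_on_trmx R _ U Uo.
have sM := @smooth_on_mulmx R _ U Uo.
apply: (smooth_onB Uo sF); apply: (sM); first exact: sM.
apply: (smooth_onZ Uo); apply: (smooth_onD Uo); last apply: (sT).
  by apply: (sM) => //; apply: (sM) => //; apply: (sT).
by apply: (sM) => //; apply: (sM) => //; apply: (sT).
Qed.

(** Projecting a constant matrix field at each point of the manifold extends any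
    tangent vector; the projection is polynomial in the point. *)
Lemma tangent_field X u : iSt A J X -> tangent A X u ->
  exists2 F, vector_field (iSt A J) (tangent A) F & F X = u.
Proof.
move=> XJ Tu; exists (fun y => proj_tan A J y u); last exact: proj_tan_id.
split=> [x Mx|x Mx]; last exact: tangent_proj.
exists setT, (fun y => proj_tan A J y u); split=> //; first exact: openT.
by apply: smooth_proj_tan; [exact: openT|exact/smooth_on_cst/openT].
Qed.

(** The Cayley transform of an element of the Lie algebra of the group that
    preserves [A] lies in that group. *)
Lemma cayley_iSt X (K : 'M[R]_n) : iSt A J X -> K^T *m A = - (A *m K) ->
  1%:M - K \in unitmx -> iSt A J ((1%:M + K) *m invmx (1%:M - K) *m X).
Proof.
move=> XJ AK uK; rewrite /iSt /= -[RHS]XJ.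
set N := invmx _.
have e1 : (1%:M + K)^T *m A = A *m (1%:M - K).
  by rewrite trmxD trmx1 mulmxDl mulmxBr AK mul1mx mulmx1.
have e2 : A *m (1%:M + K) = (1%:M - K)^T *m A.
  by rewrite trmxB trmx1 mulmxDr mulmxBl AK mul1mx mulmx1 opprK.
have e3 : (1%:M - K) *m (1%:M + K) = (1%:M + K) *m (1%:M - K).
  by rewrite mulmxBl mulmxBr mul1mx mulmx1 mulmxDr mulmxDl mul1mx mulmx1.
have e4 : N^T *m (1%:M - K)^T = 1%:M by rewrite -trmx_mul mulmxV// trmx1.
rewrite !trmx_mul -!mulmxA (mulmxA (1%:M + K)^T) e1 -!mulmxA (mulmxA (1%:M - K)) e3.
rewrite -!mulmxA (mulmxA (1%:M - K) N) mulmxV// mul1mx.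
by rewrite (mulmxA A (1%:M + K)) e2 -!mulmxA (mulmxA N^T) e4 mul1mx.
Qed.

(** The group preserving [A] acts on the manifold, and its infinitesimal action
    reaches every tangent vector: [W = F *m A] with [F] skew-symmetric is in the
    Lie algebra, and [F] is chosen so that [W *m X = u]. The Cayley transform of
    [t / 2 *: W] moves [X] along a rational curve, so that no matrix exponential
    or square root is needed. *)
Lemma curve_iSt X u : iSt A J X -> tangent A X u ->
  exists c, curve_through (iSt A J) X u c.
Proof.
move=> XJ Tu.
have [Om eOm] : exists Om, Om = X^T *m A *m u by eexists.
have sOm : Om^T = - Om by rewrite eOm; exact/tangentP.
(* The first term alone gives [W *m X = u]. The second makes [F] skew-symmetric
   but adds [X *m J *m Om] to [W *m X], which the third, itself skew-symmetric,
   removes again. *)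
pose F := u *m J *m X^T - X *m J *m u^T - X *m (J *m Om *m J) *m X^T.
pose W := F *m A.
have AW : W^T *m A = - (A *m W).
  rewrite /W trmx_mul A_sym -!mulmxA -mulmxN; congr (A *m _); rewrite -mulNmx; congr (_ *m A).
  rewrite /F !trmxB !trmx_mul !trmxK J_sym sOm !(mulmxN, mulNmx) !mulmxA.
  by rewrite opprK !opprB addrC.
have WX : W *m X = u.
  rewrite /W /F !mulmxBl -!mulmxA (mulmxA X^T A X) XJ J_sqr mulmx1.
  have -> : u^T *m (A *m X) = - Om by rewrite -sOm eOm !trmx_mul trmxK A_sym.
  by rewrite mulmx1 !mulmxN opprK addrK.
exists (fun t => (1%:M + (t / 2) *: W) *m invmx (1%:M - (t / 2) *: W) *m X).
have dK : is_diff (0 : R) (fun t : R => (t / 2) *: W) (fun s : R => (s / 2) *: W).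
  apply: (is_diff_ext _ _ (is_diff_scalel 0 (2^-1 *: W))) => t; by rewrite scalerA.
have K0 : (0 / 2) *: W = 0 :> 'M[R]_n by rewrite mul0r scale0r.
have uK0 : 1%:M - (0 / 2) *: W \in unitmx by rewrite K0 subr0 unitmx1.
have dP : is_diff (0 : R) (fun t : R => 1%:M + (t / 2) *: W) (fun s => 0 + (s / 2) *: W) :=
  is_diffD (is_diff_cst (1%:M : 'M[R]_n) (0 : R)) dK.
have dN : is_diff (0 : R) (fun t : R => 1%:M - (t / 2) *: W) (fun s => 0 - (s / 2) *: W) :=
  is_diffB (is_diff_cst (1%:M : 'M[R]_n) (0 : R)) dK.
have dc := is_diff_mulmx (is_diff_mulmx dP (is_diff_invmx dN uK0)) (is_diff_cst X (0 : R)).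
split.
- by rewrite mul0r scale0r addr0 subr0 invmx1 !mul1mx.
- have /(_ 1) := is_diff_derive _ dc => e.
  apply: DeriveDef; first exact: (diff_derivable (is_diff_differentiable dc)).
  apply: (etrans e); clear e.
  cbv beta.
  rewrite K0 addr0 subr0 invmx1 mulmx0 addr0 add0r sub0r !mul1mx !mulmx1 opprK.
  by rewrite -scalerDl -splitr scale1r WX.
have near_unit : \forall t \near (0 : R), 1%:M - (t / 2) *: W \in unitmx.
  apply: (near_unitmx (F := fun t : R => 1%:M - (t / 2) *: W) (x := 0 : R) _ uK0); apply: differentiable_continuous.
  by apply: differentiable_det => i j; exact: is_diff_differentiable (is_diff_entry i j dN).
apply: filterS near_unit => t ut; apply: cayley_iSt => //.
by rewrite trmxZ -scalemxAl AW -scalemxAr scalerN.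
Qed.

End Geometry.

(** * The Euclidean gradient and the ambient open set *)

Section EuclideanGradient.
Context (R : realType) (n p : nat).
Implicit Types (X Z : 'M[R]_(n, p)) (f : 'M[R]_(n, p) -> R).

Lemma egradP f X : differentiable f X ->
  forall Z, \tr ((egrad f X)^T *m Z) = 'D_Z f X.
Proof.
move=> df.
apply: (@getPex _ [set v : 'M[R]_(n, p) | forall Z, \tr (v^T *m Z) = 'D_Z f X]).
exists (\matrix_(i, j) 'd f X (delta_mx i j)) => Z /=.
rewrite deriveE// [in RHS](matrix_sum_delta Z) linear_sum/= mxtrace_mulC.
rewrite /mxtrace; apply: eq_bigr => i _; rewrite mxE linear_sum/=.
by apply: eq_bigr => j _; rewrite !mxE linearZ.
Qed.

Lemma egrad_entry f X i j : differentiable f X ->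
  egrad f X i j = 'D_(delta_mx i j) f X.
Proof. by move=> df; rewrite -egradP// mxtrace_mul_delta. Qed.

Lemma smooth_egrad (U : set 'M[R]_(n, p)) f :
  open U -> smooth_on U f -> smooth_on U (egrad f).
Proof.
move=> Uo sf; apply: smooth_on_mx => // i j k.
apply: (@Ck_on_eq _ _ _ Uo _ _ ('D_(delta_mx i j) f)) => [X UX|].
  by rewrite egrad_entry//; exact: smooth_on_differentiable sf UX.
exact: smooth_on_derive.
Qed.

End EuclideanGradient.

Section Domain.
Context (R : realType) (n p : nat).
Local Notation V := 'M[R]_(n, p).

Lemma open_unitmx m (U : set V) (F : V -> 'M[R]_m) : open U -> smooth_on U F ->
  open (U `&` [set X | F X \in unitmx]).
Proof.
move=> Uo sF; rewrite openE => X [UX uX]; apply: filterI.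
  exact: (open_nbhs_nbhs (conj Uo UX)).
apply: (near_unitmx (F := F) _ uX); apply: differentiable_continuous.
apply: differentiable_det => i j.
exact: (is_diff_differentiable (is_diff_entry i j (smooth_on_is_diff sF UX))).
Qed.

Lemma smooth_gram (B : 'M[R]_n) (U : set V) : open U -> smooth_on U (fun X : V => X^T *m B *m X).
Proof.
move=> Uo; have sid := smooth_on_id (V := V) Uo.
apply: smooth_on_mulmx => //; apply: smooth_on_mulmx => //; last exact: smooth_on_cst.
exact: (smooth_on_trmx Uo sid).
Qed.

Lemma ambientE (A : 'M[R]_n) : ambient p A =
  (setT `&` [set X : V | X^T *m 1%:M *m X \in unitmx]) `&` [set X : V | X^T *m A *m X \in unitmx].
Proof.
apply/seteqP; split=> X /=; rewrite !unitmxE !unitfE mulmx1.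
  by move=> [/eqP ? /eqP ?].
by move=> [[_ /eqP ?] /eqP ?].
Qed.

Lemma open_ambient (A : 'M[R]_n) : open (ambient p A).
Proof.
rewrite ambientE.
have o1 : open (setT `&` [set X : V | X^T *m 1%:M *m X \in unitmx]).
  by apply: open_unitmx; [exact: openT|exact/smooth_gram/openT].
by apply: open_unitmx => //; exact: smooth_gram.
Qed.

(** If [w] is in the kernel of the Gram matrix then [X *m w^T] has norm zero, so
    [J *m w^T] vanishes, and [J] is invertible. *)
Lemma iSt_ambient (A : 'M[R]_n) (J : 'M[R]_p) : J *m J = 1%:M ->
  iSt A J `<=` ambient p A.
Proof.
move=> JJ X XJ; rewrite ambientE /=.
have uJ : J \in unitmx by case/mulmx1_unit: JJ.
rewrite mulmx1 XJ; split=> //; split=> //.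
rewrite -row_free_unit -kermx_eq0; apply/eqP.
apply/row_matrixP => i; rewrite row0.
set w := row i _.
have wX : w *m (X^T *m X) = 0 by rewrite -row_mul mulmx_ker row0.
have wX0 : X *m w^T = 0.
  apply: mxtrace_sqr_eq0.
  by rewrite trmx_mul trmxK mulmxA -[w *m _ *m _]mulmxA wX mul0mx mxtrace0.
have : J *m w^T = 0 by rewrite -XJ -mulmxA wX0 mulmx0.
by move=> /(congr1 (mulmx (invmx J))); rewrite mulKmx// mulmx0 => /(congr1 trmx); rewrite trmxK trmx0.
Qed.

End Domain.

(** * Gradient and Hessian for a metric with prescribed [G X *m X] *)

Section InducedMetric.
Context (R : realType) (n p : nat) (A : 'M[R]_n) (J : 'M[R]_p) (rho : R).
Hypotheses (A_sym : A^T = A) (J_sym : J^T = J) (J_sqr : J *m J = 1%:M).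
Hypothesis (rho_gt0 : 0 < rho).
Local Notation V := 'M[R]_(n, p).
Local Notation M := (iSt A J : set V).
Local Notation T := (@tangent R n p A).
Context (G : V -> 'M[R]_n).
Hypothesis G_sym : forall X, (G X)^T = G X.
Hypothesis G_smooth : smooth_on (ambient p A) G.
Hypothesis G_unit : forall X, M X -> G X \in unitmx.
Hypothesis G_iSt : forall X, M X -> G X *m X = rho^-1 *: (A *m X *m J).
Hypothesis G_def : forall X v, M X -> metric G X v v = 0 -> v = 0.
Local Notation g := (metric G).
Local Notation P := (proj_tan A J).

(** The projection removes matrices [X *m J *m s] with [s] symmetric. By the form
    of [G X *m X], the inner product of such a matrix with a tangent vector is
    the trace of a symmetric times a skew-symmetric matrix. *)
Lemma orth_proj_tan X : M X -> is_orth_proj (T X) (g X) (P X).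
Proof.
move=> XJ Y; split=> [|Z TZ]; first exact: tangent_proj.
have XG : X^T *m G X = rho^-1 *: (J *m X^T *m A).
  by rewrite -[LHS]trmxK trmx_mul trmxK G_sym G_iSt// trmxZ !trmx_mul A_sym J_sym mulmxA.
rewrite /metric /proj_tan opprB addrC subrK !trmx_mul trmx_sym J_sym.
move: (sym _) (trmx_sym (X^T *m A *m Y)) => s ss.
rewrite -!mulmxA [X^T *m _]mulmxA XG -scalemxAl -!scalemxAr !mulmxA.
rewrite -[_ *m J *m J]mulmxA J_sqr mulmx1 mxtraceZ -!mulmxA mxtrace_sym_skew ?mulr0//.
by rewrite !mulmxA; exact/tangentP.
Qed.

Lemma metricB X u v w : g X (u - v) w = g X u w - g X v w.
Proof. by rewrite /metric trmxB !mulmxBl raddfB. Qed.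

Lemma tangent_unique X u v : M X -> T X u -> T X v ->
  (forall z, T X z -> g X u z = g X v z) -> u = v.
Proof.
move=> XJ Tu Tv uv; apply/eqP; rewrite -subr_eq0; apply/eqP.
apply: (G_def XJ); rewrite metricB uv ?subrr//; exact: tangentB.
Qed.

(** The orthogonal projection of [Y] is the only tangent vector whose difference
    to [Y] is orthogonal to the tangent space. *)
Lemma eq_proj_tan X u Y : M X -> T X u ->
  (forall z, T X z -> g X (u - Y) z = 0) -> u = P X Y.
Proof.
move=> XJ Tu uY; have [TP oP] := orth_proj_tan XJ Y.
apply: (tangent_unique XJ Tu TP) => z Tz.
have := uY z Tz; have := oP z Tz; rewrite !metricB; lra.
Qed.

Context (f fbar : V -> R).
Hypothesis fbar_smooth : smooth_on (ambient p A) fbar.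
Hypothesis fbar_ext : forall Y, M Y -> fbar Y = f Y.

(** On the manifold this is the Riemannian gradient; the formula makes sense
    wherever [G] is invertible, which provides the extension that is
    differentiated to obtain the Hessian. *)
Definition grad_ext Y := P Y (invmx (G Y) *m egrad fbar Y).

(** Against a tangent vector the projection may be dropped, and then [G] cancels
    its inverse. *)
Lemma metric_grad_ext X z : M X -> T X z -> g X (grad_ext X) z = 'D_z fbar X.
Proof.
move=> XJ Tz; have df := smooth_on_differentiable fbar_smooth (iSt_ambient J_sqr XJ).
have [_ /(_ _ Tz)] := orth_proj_tan XJ (invmx (G X) *m egrad fbar X).
rewrite -egradP// metricB {1}/metric trmx_mul trmx_inv G_sym mulmxKV ?G_unit// => ?.
by rewrite /grad_ext; lra.
Qed.

Lemma rgradE X : M X -> rgrad M T g f X = grad_ext X.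
Proof.
move=> XJ; have TE : T X (grad_ext X) by exact: tangent_proj.
have mderf z : T X z -> mder M f X z = g X (grad_ext X) z.
  move=> Tz; rewrite metric_grad_ext//.
  have df := smooth_on_is_diff fbar_smooth (iSt_ambient J_sqr XJ).
  apply: (mderE (curve_iSt A_sym J_sym J_sqr XJ Tz) _ df).
  by near=> y; exact: fbar_ext.
have [Tgrad grad_z] : [set v | T X v /\ forall z, T X z -> g X v z = mder M f X z] (rgrad M T g f X).
  by apply: getPex; exists (grad_ext X); split=> // z Tz; rewrite mderf.
by apply: (tangent_unique XJ) => // z Tz; rewrite grad_z// mderf.
Unshelve. all: by end_near. Qed.

Let O := ambient p A `&` [set X | G X \in unitmx].

Let open_O : open O.
Proof. exact: (open_unitmx (@open_ambient _ _ _ A) G_smooth). Qed.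

Let iSt_O : M `<=` O.
Proof. by move=> X XJ; split; [exact: iSt_ambient XJ|exact: G_unit]. Qed.

Lemma smooth_grad_ext : smooth_on O grad_ext.
Proof.
have sub (W : normedModType R) (F : V -> W) : smooth_on (ambient p A) F -> smooth_on O F.
  by move=> sF; apply: smooth_on_sub sF => X [].
apply: smooth_proj_tan => //; apply: smooth_on_mulmx => //.
  by apply: smooth_on_invmx => [//|X []//|]; exact: sub.
by apply: smooth_egrad => //; exact: sub.
Qed.

Lemma vector_field_rgrad : vector_field M T (rgrad M T g f).
Proof.
split=> X XJ; last by rewrite rgradE//; exact: tangent_proj.
exists O, grad_ext; split=> //; [exact: iSt_O|exact: smooth_grad_ext|].
by move=> Y YJ _; rewrite rgradE.
Qed.

(** The relation [G_iSt], inverted and transposed. *)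
Lemma invmxG_iSt X : M X -> X^T *m A *m invmx (G X) = rho *: (J *m X^T).
Proof.
move=> XJ; have rho0 : rho != 0 by rewrite gt_eqF.
have e : invmx (G X) *m (A *m X) = rho *: (X *m J).
  have := congr1 (fun Z => rho *: (invmx (G X) *m Z *m J)) (G_iSt XJ).
  rewrite mulmxA mulVmx ?G_unit// mul1mx => ->.
  by rewrite -scalemxAr -scalemxAl scalerA divff// scale1r -!mulmxA J_sqr mulmx1.
by apply: trmx_inj; rewrite !trmx_mul trmx_inv G_sym A_sym trmxK e trmxZ trmx_mul trmxK J_sym.
Qed.

(** Differentiating the projection yields, besides the projected derivative of
    its argument, one term that starts with [xi] and one of the form
    [X *m J *m s] with [s] symmetric; the outer projection kills the latter. *)
Lemma proj_derive_grad_ext X xi : M X -> T X xi ->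
  P X ('D_xi grad_ext X) =
  P X (- (invmx (G X) *m 'D_xi G X *m invmx (G X) *m egrad fbar X)
       + invmx (G X) *m ehess fbar X xi
       - rho *: (xi *m J *m sym (J *m X^T *m egrad fbar X))).
Proof.
move=> XJ Txi; have aX := iSt_ambient J_sqr XJ.
have dG := smooth_on_is_diff G_smooth aX.
have dgE := smooth_on_is_diff (smooth_egrad (@open_ambient _ _ _ A) fbar_smooth) aX.
have dY := is_diff_mulmx (is_diff_invmx dG (G_unit XJ)) dgE.
have dXA := is_diff_mulmx (is_diff_trmx (is_diff_id X)) (is_diff_cst A X).
have ds := is_diff_sym (is_diff_mulmx dXA dY).
have dXJ := is_diff_mulmx (is_diff_id X) (is_diff_cst J X).
have dgrad := is_diffB dY (is_diff_mulmx dXJ ds).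
set Gi := invmx (G X) in dgrad *; set gE := egrad fbar X in dgrad *.
pose Y := Gi *m gE.
pose dYxi := - (Gi *m 'D_xi G X *m Gi *m gE) + Gi *m ehess fbar X xi.
have DE : 'D_xi grad_ext X =
    dYxi - (xi *m J *m sym (X^T *m A *m Y)
            + X *m J *m (sym (xi^T *m A *m Y) + sym (X^T *m A *m dYxi))).
  apply: (etrans (is_diff_derive xi dgrad)).
  change ((- (Gi *m 'D_xi G X *m Gi) *m gE + Gi *m 'D_xi (egrad fbar) X)
    - ((xi *m J + X *m 0) *m sym (X^T *m A *m Y)
       + X *m J *m sym ((xi^T *m A + X^T *m 0) *m Y + X^T *m A *m
          (- (Gi *m 'D_xi G X *m Gi) *m gE + Gi *m 'D_xi (egrad fbar) X))) =
    dYxi - (xi *m J *m sym (X^T *m A *m Y)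
            + X *m J *m (sym (xi^T *m A *m Y) + sym (X^T *m A *m dYxi)))).
  by rewrite !mulmx0 !addr0 mulNmx -symD.
have -> : 'D_xi grad_ext X = P X dYxi - (xi *m J *m sym (X^T *m A *m Y)
    + X *m J *m sym (xi^T *m A *m Y)).
  rewrite DE [_ *m (_ + _)]mulmxDr /proj_tan addrA opprD [LHS]addrA.
  by rewrite addrAC.
have sY : sym (X^T *m A *m Y) = rho *: sym (J *m X^T *m gE).
  by rewrite /Y mulmxA invmxG_iSt// -scalemxAl symZ.
rewrite proj_tanB [P X (_ *m sym _ + _)]proj_tanD proj_tan_vertical ?trmx_sym// addr0.
by rewrite proj_tan_id ?[RHS]proj_tanB ?sY -?scalemxAr//; exact: tangent_proj.
Qed.

(** By the Koszul formula the covariant derivative and the sum on the right-hand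
    side have the same inner products with tangent vectors; the former is tangent,
    hence the projection of the latter. Here [kappa] is any matrix that represents
    the Koszul terms. *)
Lemma rhess_proj nabla X xi kappa :
  is_levi_civita M T g nabla -> M X -> T X xi ->
  (forall z, T X z -> 2 * \tr (kappa^T *m z) =
     \tr ((grad_ext X)^T *m 'D_xi G X *m z)
     + \tr (xi^T *m 'D_(grad_ext X) G X *m z)
     - \tr (xi^T *m 'D_z G X *m grad_ext X)) ->
  rhess M T g nabla f X xi = P X ('D_xi grad_ext X + invmx (G X) *m kappa).
Proof.
move=> lc XJ Txi kappaP; apply: eq_proj_tan => //.
  exact: (conn_tangent (lc_connection lc) XJ Txi vector_field_rgrad).
move=> z Tz; rewrite opprD addrA metricB.
have dgrad := smooth_on_is_diff smooth_grad_ext (iSt_O XJ).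
have gradE : \forall y \near X, M y -> grad_ext y = rgrad M T g f y.
  by near=> y; move=> yJ; rewrite rgradE.
have dG := smooth_on_is_diff G_smooth (iSt_ambient J_sqr XJ).
have := koszul (curve_iSt A_sym J_sym J_sqr) (tangent_field A_sym J_sqr)
  (tangentB A_sym) G_sym lc XJ Txi Tz vector_field_rgrad dgrad gradE dG.
rewrite -/(rhess M T g nabla f X xi) rgradE// -kappaP// => ?.
have -> : g X (invmx (G X) *m kappa) z = \tr (kappa^T *m z).
  by rewrite /metric trmx_mul trmx_inv G_sym mulmxKV ?G_unit.
lra.
Unshelve. all: by end_near. Qed.

(** The correction term is split into a part that is normal, a part [W] that is
    already tangent and a part [Z] that is left under the projection, which is
    the shape of the Hessian formulas. *)
Lemma rhess_decomp nabla X xi kappa (sigma : 'M[R]_p) W Z :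
  is_levi_civita M T g nabla -> M X -> T X xi ->
  (forall z, T X z -> 2 * \tr (kappa^T *m z) =
     \tr ((rgrad M T g f X)^T *m 'D_xi G X *m z)
     + \tr (xi^T *m 'D_(rgrad M T g f X) G X *m z)
     - \tr (xi^T *m 'D_z G X *m rgrad M T g f X)) ->
  invmx (G X) *m kappa = X *m J *m sigma + W + Z ->
  sigma^T = sigma -> T X W ->
  rhess M T g nabla f X xi =
  W + P X (Z - invmx (G X) *m 'D_xi G X *m invmx (G X) *m egrad fbar X
           + invmx (G X) *m ehess fbar X xi
           - rho *: (xi *m J *m sym (J *m X^T *m egrad fbar X))).
Proof.
move=> lc XJ Txi kappaP Gkappa sT TW; rewrite rgradE// in kappaP.
rewrite (rhess_proj lc XJ Txi kappaP) proj_tanD proj_derive_grad_ext//.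
have -> : P X (invmx (G X) *m kappa) = W + P X Z.
  by rewrite Gkappa proj_tanD [P X (_ + W)]proj_tanD proj_tan_vertical// add0r proj_tan_id.
by rewrite addrCA [P X _ + P X Z]addrC -proj_tanD !addrA.
Qed.

End InducedMetric.

(** * The two metrics *)

(** Taking the symmetric part is self-adjoint for the trace pairing. *)
Lemma mxtrace_sym_adj (R : realType) m (S T : 'M[R]_m) :
  \tr (sym S *m T) = \tr (S *m sym T).
Proof.
rewrite /sym -scalemxAl -scalemxAr mulmxDl mulmxDr !mxtraceZ !mxtraceD.
by rewrite -[\tr (S^T *m T)]mxtrace_tr trmx_mul trmxK [\tr (T^T *m S)]mxtrace_mulC.
Qed.

Lemma invmx_eq (R : realType) m (S T : 'M[R]_m) : S *m T = 1%:M ->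
  S \in unitmx /\ invmx S = T.
Proof.
move=> ST; have [uS _] := mulmx1_unit ST; split=> //.
by rewrite -[RHS]mul1mx -(mulVmx uS) -mulmxA ST mulmx1.
Qed.

Section TwoMetrics.
Context (R : realType) (n p : nat) (A : 'M[R]_n) (J : 'M[R]_p) (rho : R).
Hypotheses (A_sym : A^T = A) (A_unit : A \in unitmx).
Hypotheses (J_sym : J^T = J) (J_sqr : J *m J = 1%:M).
Hypothesis (rho_gt0 : 0 < rho).
Local Notation V := 'M[R]_(n, p).
Local Notation M := (iSt A J : set V).
Local Notation T := (@tangent R n p A).
Implicit Types X u v : V.

Local Notation S := (S_mx A J).
Local Notation Pi := (@Pi_mx R n p).
Local Notation Mi := (@gram_inv R n p).

Lemma trmx_S X : (S X)^T = S X.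
Proof. by rewrite /S_mx trmxB !trmx_mul trmxK A_sym J_sym !mulmxA. Qed.

Lemma trmx_gram_inv X : (Mi X)^T = Mi X.
Proof. by rewrite /gram_inv trmx_inv trmx_mul trmxK. Qed.

Lemma trmx_Pi X : (Pi X)^T = Pi X.
Proof. by rewrite /Pi_mx trmxB trmx1 !trmx_mul trmxK trmx_gram_inv mulmxA. Qed.

Lemma S_iSt X : M X -> S X *m X = 0.
Proof. by move=> XJ; rewrite /S_mx mulmxBl -!mulmxA (mulmxA X^T) XJ J_sqr mulmx1 subrr. Qed.

Lemma iSt_S X : M X -> X^T *m S X = 0.
Proof. by move=> XJ; apply: trmx_inj; rewrite trmx_mul trmxK trmx_S S_iSt// trmx0. Qed.

Lemma unit_gram X : M X -> X^T *m X \in unitmx.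
Proof. by move=> /(iSt_ambient J_sqr)[/eqP]; rewrite unitmxE unitfE. Qed.

Lemma Pi_iSt X : M X -> Pi X *m X = 0.
Proof.
move=> XJ; rewrite /Pi_mx mulmxBl mul1mx -!mulmxA mulVmx ?unit_gram//.
by rewrite mulmx1 subrr.
Qed.

Lemma iSt_Pi X : M X -> X^T *m Pi X = 0.
Proof. by move=> XJ; apply: trmx_inj; rewrite trmx_mul trmxK trmx_Pi Pi_iSt// trmx0. Qed.

Lemma S_Pi X : M X -> S X *m Pi X = S X.
Proof. by move=> XJ; rewrite /Pi_mx mulmxBr mulmx1 !mulmxA S_iSt// !mul0mx subr0. Qed.

Lemma Pi_S X : M X -> Pi X *m S X = S X.
Proof. by move=> XJ; apply: trmx_inj; rewrite trmx_mul trmx_S trmx_Pi S_Pi. Qed.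

Lemma Pi_idem X : M X -> Pi X *m Pi X = Pi X.
Proof. by move=> XJ; rewrite {2}/Pi_mx mulmxBr mulmx1 !mulmxA Pi_iSt// !mul0mx subr0. Qed.

Lemma invA_S X : invmx A *m S X = 1%:M - X *m J *m X^T *m A.
Proof. by rewrite /S_mx mulmxBr mulVmx// -!mulmxA mulKmx// !mulmxA. Qed.

Lemma S_invA X : S X *m invmx A = 1%:M - A *m X *m J *m X^T.
Proof. by rewrite /S_mx mulmxBl mulmxV// mulmxK. Qed.

(** The two summands of [G1] are inverted separately: on the span of [X] by
    [rho *: (X *m X^T)], and on the complement by the second term, since [S_mx]
    kills [X] and [Pi_mx] is annihilated by [X^T]. *)
Lemma G1_inv X : M X -> G1 A J rho X \in unitmx /\
  invmx (G1 A J rho X) = rho *: (X *m X^T) + invmx A *m Pi X *m invmx A.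
Proof.
move=> XJ; apply: invmx_eq.
have rho0 : rho != 0 by rewrite gt_eqF.
have h1 : A *m X *m X^T *m A *m (X *m X^T) = A *m X *m J *m X^T.
  by rewrite mulmxA -!(mulmxA (A *m X)) XJ !mulmxA.
have h2 : S X *m S X *m (X *m X^T) = 0.
  by rewrite mulmxA -[_ *m X]mulmxA S_iSt// mulmx0 mul0mx.
have h3 : A *m X *m X^T *m A *m (invmx A *m Pi X *m invmx A) = 0.
  by rewrite !mulmxA mulmxK// -[A *m X *m X^T *m _]mulmxA iSt_Pi// mulmx0 mul0mx.
have h4 : S X *m S X *m (invmx A *m Pi X *m invmx A) = 1%:M - A *m X *m J *m X^T.
  rewrite !mulmxA -[S X *m S X *m _]mulmxA S_invA -(mulmxA (S X)) [(_ - _) *m Pi X]mulmxBl mul1mx.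
  by rewrite -(mulmxA _ X^T) iSt_Pi// mulmx0 subr0 S_Pi// S_invA.
rewrite /G1 mulmxDl (mulmxDr (_ *: _)) (mulmxDr (S X *m S X)) -!scalemxAl -!scalemxAr h1 h2 h3 h4.
by rewrite !scaler0 addr0 add0r scalerA mulVf// scale1r addrC subrK.
Qed.

(** As for [G1_inv], with the roles of [S_mx] and [Pi_mx] exchanged. *)
Lemma G2_inv X : M X -> G2 A rho X \in unitmx /\
  invmx (G2 A rho X) = rho *: (X *m X^T) + invmx A *m S X *m S X *m invmx A.
Proof.
move=> XJ; apply: invmx_eq.
have rho0 : rho != 0 by rewrite gt_eqF.
have h1 : A *m X *m X^T *m A *m (X *m X^T) = A *m X *m J *m X^T.
  by rewrite mulmxA -!(mulmxA (A *m X)) XJ !mulmxA.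
have h2 : Pi X *m (X *m X^T) = 0 by rewrite mulmxA Pi_iSt// mul0mx.
have h3 : A *m X *m X^T *m A *m (invmx A *m S X *m S X *m invmx A) = 0.
  by rewrite !mulmxA mulmxK// -[A *m X *m X^T *m _]mulmxA iSt_S// mulmx0 !mul0mx.
have h4 : Pi X *m (invmx A *m S X *m S X *m invmx A) = 1%:M - A *m X *m J *m X^T.
  rewrite !mulmxA -(mulmxA (Pi X) (invmx A)) invA_S [Pi X *m (1%:M - _)]mulmxBr mulmx1.
  by rewrite !mulmxA Pi_iSt// !mul0mx subr0 Pi_S// S_invA.
rewrite /G2 mulmxDl (mulmxDr (_ *: _)) (mulmxDr (Pi X)) -!scalemxAl -!scalemxAr h1 h2 h3 h4.
by rewrite !scaler0 addr0 add0r scalerA mulVf// scale1r addrC subrK.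
Qed.

Lemma G1_sym X : (G1 A J rho X)^T = G1 A J rho X.
Proof. by rewrite /G1 trmxD trmxZ !trmx_mul trmxK trmx_S A_sym !mulmxA. Qed.

Lemma G2_sym X : (G2 A rho X)^T = G2 A rho X.
Proof. by rewrite /G2 trmxD trmxZ !trmx_mul trmxK trmx_Pi A_sym !mulmxA. Qed.

Lemma G1_iSt X : M X -> G1 A J rho X *m X = rho^-1 *: (A *m X *m J).
Proof.
move=> XJ; rewrite /G1 mulmxDl -[S X *m S X *m X]mulmxA S_iSt// mulmx0 addr0.
by rewrite -scalemxAl -!(mulmxA (A *m X)) XJ.
Qed.

Lemma G2_iSt X : M X -> G2 A rho X *m X = rho^-1 *: (A *m X *m J).
Proof.
move=> XJ; rewrite /G2 mulmxDl Pi_iSt// addr0.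
by rewrite -scalemxAl -!(mulmxA (A *m X)) XJ.
Qed.

(** The quadratic form is a sum of two squared norms. If both vanish then
    [S_mx A J X *m v] reduces to [A *m v], which is therefore zero. *)
Lemma G1_def X v : M X -> metric (G1 A J rho) X v v = 0 -> v = 0.
Proof.
move=> XJ; have -> : metric (G1 A J rho) X v v =
    rho^-1 * \tr ((X^T *m A *m v)^T *m (X^T *m A *m v)) + \tr ((S X *m v)^T *m (S X *m v)).
  rewrite /metric /G1 mulmxDr mulmxDl mxtraceD -scalemxAr -scalemxAl mxtraceZ.
  by rewrite !trmx_mul trmxK trmx_S A_sym !mulmxA.
have rho_inv_gt0 : 0 < rho^-1 by rewrite invr_gt0.
move/eqP; rewrite paddr_eq0 ?mulr_ge0 ?mxtrace_sqr_ge0 ?(ltW rho_inv_gt0)//.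
rewrite mulf_eq0 gt_eqF//= => /andP[/eqP/mxtrace_sqr_eq0 Xv /eqP/mxtrace_sqr_eq0].
rewrite /S_mx mulmxBl -!mulmxA (mulmxA X^T) Xv !mulmx0 subr0.
by move=> /(congr1 (mulmx (invmx A))); rewrite mulKmx// mulmx0.
Qed.

(** The quadratic form is a sum of two squared norms. If both vanish then [v] is
    [X] times some [w] with [J *m w = 0]. *)
Lemma G2_def X v : M X -> metric (G2 A rho) X v v = 0 -> v = 0.
Proof.
move=> XJ; have -> : metric (G2 A rho) X v v =
    rho^-1 * \tr ((X^T *m A *m v)^T *m (X^T *m A *m v)) + \tr ((Pi X *m v)^T *m (Pi X *m v)).
  rewrite /metric /G2 mulmxDr mulmxDl mxtraceD -scalemxAr -scalemxAl mxtraceZ.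
  by rewrite !trmx_mul trmxK trmx_Pi A_sym !mulmxA -[_ *m Pi X *m Pi X]mulmxA Pi_idem.
have rho_inv_gt0 : 0 < rho^-1 by rewrite invr_gt0.
move/eqP; rewrite paddr_eq0 ?mulr_ge0 ?mxtrace_sqr_ge0 ?(ltW rho_inv_gt0)//.
rewrite mulf_eq0 gt_eqF//= => /andP[/eqP/mxtrace_sqr_eq0 Xv /eqP/mxtrace_sqr_eq0].
rewrite /Pi_mx mulmxBl mul1mx => /eqP; rewrite subr_eq0 => /eqP vE.
have Jw : J *m (Mi X *m X^T *m v) = 0.
  by rewrite -XJ -!mulmxA [X *m (Mi X *m _)]mulmxA [X *m Mi X *m _]mulmxA -vE mulmxA.
rewrite vE -!mulmxA (mulmxA (Mi X)).
by rewrite -[Mi X *m X^T *m v]mul1mx -J_sqr -mulmxA Jw !mulmx0.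
Qed.

Lemma smooth_G1 (U : set V) : open U -> smooth_on U (G1 A J rho).
Proof.
move=> Uo; have sid := smooth_on_id (V := V) Uo.
have scst m q (B : 'M[R]_(m, q)) : smooth_on U (fun=> B) by exact: smooth_on_cst.
have sT := @smooth_on_trmx R _ U Uo.
have sM := @smooth_on_mulmx R _ U Uo.
have sA : smooth_on U (fun X : V => A *m X) by apply: (sM).
have sTA : smooth_on U (fun X : V => X^T *m A) by apply: (sM) => //; apply: (sT).
have sS : smooth_on U (fun X : V => S X).
  apply: (smooth_onB Uo) => //; apply: (sM) => //; apply: (sM); last exact: (sT).
  exact: (sM).
apply: (smooth_onD Uo); last exact: (sM).
apply: (smooth_onZ Uo); apply: (sM) => //; apply: (sM) => //; exact: (sT).
Qed.

Lemma smooth_G2 : smooth_on (ambient p A) (G2 A rho).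
Proof.
have Uo := @open_ambient R n p A; have sid := smooth_on_id (V := V) Uo.
have scst m q (B : 'M[R]_(m, q)) : smooth_on (ambient p A) (fun=> B) by exact: smooth_on_cst.
have sT := @smooth_on_trmx R _ _ Uo.
have sM := @smooth_on_mulmx R _ _ Uo.
have sA : smooth_on (ambient p A) (fun X : V => A *m X) by apply: (sM).
have sXT : smooth_on (ambient p A) (fun X : V => X^T) by apply: (sT).
have sMi : smooth_on (ambient p A) (fun X : V => Mi X).
  apply: (smooth_on_invmx Uo) => [X [/eqP]|]; first by rewrite unitmxE unitfE.
  exact: (sM).
apply: (smooth_onD Uo).
  by apply: (smooth_onZ Uo); apply: (sM) => //; exact: (sM).
by apply: (smooth_onB Uo) => //; apply: (sM) => //; exact: (sM).
Qed.

End TwoMetrics.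

(** * Derivatives of the two metrics and their Koszul terms *)

(** Matrix identities that hold in the free abelian group on the products that
    occur in them: the products become variables, and the identity is checked
    entrywise. *)
Ltac mx_abel :=
  repeat match goal with |- context [@mulmx ?R ?m ?n ?p ?a ?b] =>
    let h := fresh "mx" in set h := (@mulmx _ m n p a b); clearbody h end;
  apply/matrixP => ? ?; rewrite !mxE; ring.

(** Linear arithmetic with the traces as variables. *)
Ltac tr_lin :=
  repeat match goal with |- context [@mxtrace ?R ?m ?a] =>
    let h := fresh "tr" in set h := (@mxtrace _ m a); clearbody h end; lra.

Section Christoffel.
Context (R : realType) (n p : nat) (A : 'M[R]_n) (J : 'M[R]_p) (rho : R).
Hypotheses (A_sym : A^T = A) (A_unit : A \in unitmx).
Hypotheses (J_sym : J^T = J) (J_sqr : J *m J = 1%:M).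
Hypothesis (rho_gt0 : 0 < rho).
Local Notation V := 'M[R]_(n, p).
Local Notation M := (iSt A J : set V).
Local Notation T := (@tangent R n p A).
Implicit Types X u v xi eta z : V.

Local Notation S := (S_mx A J).
Local Notation Pi := (@Pi_mx R n p).
Local Notation Mi := (@gram_inv R n p).

Lemma is_diff_AXXA X : is_diff X (fun Y : V => A *m Y *m Y^T *m A)
  (fun v => A *m (v *m X^T + X *m v^T) *m A).
Proof.
have dAX := is_diff_mulmxl A (is_diff_id X).
have d := is_diff_mulmxr A (is_diff_mulmx dAX (is_diff_trmx (is_diff_id X))).
by apply: is_diff_ext d => // v; rewrite mulmxDr !mulmxA.
Qed.

Lemma is_diff_S X : is_diff X (fun Y : V => S Y)
  (fun v => - (A *m (v *m J *m X^T + X *m J *m v^T) *m A)).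
Proof.
have dAXJ := is_diff_mulmxr J (is_diff_mulmxl A (is_diff_id X)).
have d := is_diff_mulmxr A (is_diff_mulmx dAXJ (is_diff_trmx (is_diff_id X))).
by apply: is_diff_ext (is_diff_cstB A d) => // v; rewrite mulmxDr !mulmxA.
Qed.

(** The Gram inverse contributes two terms, which complete the derivatives of the
    outer factors [X] and [X^T] to their images under [Pi_mx]. *)
Lemma is_diff_Pi X : M X -> is_diff X (fun Y : V => Pi Y)
  (fun v => - (Pi X *m v *m Mi X *m X^T + X *m Mi X *m v^T *m Pi X)).
Proof.
move=> XJ.
have dT := is_diff_trmx (is_diff_id X).
have dMi := is_diff_invmx (is_diff_mulmx dT (is_diff_id X)) (unit_gram J_sqr XJ).
have d := is_diff_mulmx (is_diff_mulmx (is_diff_id X) dMi) dT.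
apply: is_diff_ext (is_diff_cstB (1%:M : 'M[R]_n) d) => // v.
rewrite /Pi_mx -/(Mi X) !(mulmxBl, mulmxBr, mulmxDl, mulmxDr, mulmxN, mulNmx) !mulmxA.
rewrite !mul1mx !mulmx1. mx_abel.
Qed.

(** The derivative of [S_mx] is minus twice a symmetric matrix [F], so that of its
    square is minus twice the sum of [F *m S_mx A J X] and its transpose. *)
Lemma is_diff_G1 X : is_diff X (G1 A J rho) (fun v =>
  rho^-1 *: (A *m (v *m X^T + X *m v^T) *m A)
  - 4 *: sym (A *m sym (X *m J *m v^T) *m A *m S X)).
Proof.
have d := is_diff_mulmx (is_diff_S X) (is_diff_S X).
apply: is_diff_ext (is_diff_add (is_diff_scale rho^-1 (is_diff_AXXA X)) d) => // v.
congr (_ + _).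
set F := A *m sym (X *m J *m v^T) *m A.
have -> : A *m (v *m J *m X^T + X *m J *m v^T) *m A = 2 *: F.
  rewrite /F /sym -scalemxAr -scalemxAl scalerA divff ?pnatr_eq0// scale1r addrC.
  by rewrite !trmx_mul trmxK J_sym mulmxA.
have FT : F^T = F by rewrite /F !trmx_mul trmx_sym A_sym mulmxA.
rewrite /sym trmx_mul FT trmx_S// scalerA -!scaleNr -scalemxAl -scalemxAr -scalerDr.
by congr (_ *: _); rewrite -[RHS]/(-4 * 2^-1); lra.
Qed.

Lemma is_diff_G2 X : M X -> is_diff X (G2 A rho) (fun v =>
  rho^-1 *: (A *m (v *m X^T + X *m v^T) *m A)
  - (Pi X *m v *m Mi X *m X^T + X *m Mi X *m v^T *m Pi X)).
Proof.
by move=> XJ; exact: is_diff_add (is_diff_scale rho^-1 (is_diff_AXXA X)) (is_diff_Pi XJ).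
Qed.

(** Tangency turns the two terms of the third trace into terms of the first two,
    because it exchanges [u^T *m A *m X] with minus its transpose. *)
Lemma christoffel_AXXA X xi eta z : T X xi -> T X eta ->
  let E v := A *m (v *m X^T + X *m v^T) *m A in
  \tr (eta^T *m E xi *m z) + \tr (xi^T *m E eta *m z) - \tr (xi^T *m E z *m eta) =
  2 * \tr ((A *m (X *m sym (xi^T *m A *m eta) + B_mx A X xi eta))^T *m z).
Proof.
move=> Txi Teta E; rewrite {}/E.
have skewE u : T X u -> u^T *m A *m X = - (X^T *m A *m u).
  by move=> /eqP; rewrite addr_eq0 => /eqP.
have h1 : \tr (xi^T *m A *m z *m X^T *m A *m eta) = - \tr (eta^T *m A *m X *m xi^T *m A *m z).
  rewrite [LHS](_ : _ = \tr (xi^T *m A *m z *m (X^T *m A *m eta))); last by rewrite !mulmxA.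
  by rewrite mxtrace_mulC skewE// !mulNmx raddfN opprK !mulmxA.
have h2 : \tr (xi^T *m A *m X *m z^T *m A *m eta) = - \tr (xi^T *m A *m X *m eta^T *m A *m z).
  rewrite [LHS](_ : _ = \tr (X^T *m A *m xi *m (eta^T *m A *m z))); last first.
    rewrite [RHS]mxtrace_mulC -[RHS]mxtrace_tr !trmx_mul !trmxK A_sym !mulmxA //.
  by rewrite skewE// !mulNmx raddfN opprK !mulmxA.
rewrite /B_mx /sym !(mulmxDl, mulmxDr, trmxD, trmx_mul, trmxZ, trmxK, A_sym).
rewrite -!(scalemxAl, scalemxAr) !mulmxA !(mulmxDl, mxtraceD, mxtraceZ) h1 h2; tr_lin.
Qed.

(** The first two traces give the first two summands of [C_mx] as they stand. In
    the third one, [z] is moved out of the two nested symmetric parts by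
    self-adjointness. *)
Lemma christoffel_S X xi eta z :
  let Q v := sym (A *m sym (X *m J *m v^T) *m A *m S X) in
  \tr (eta^T *m Q xi *m z) + \tr (xi^T *m Q eta *m z) - \tr (xi^T *m Q z *m eta) =
  \tr ((C_mx A J X xi eta)^T *m z).
Proof.
move=> Q; have QT v : (Q v)^T = Q v by exact: trmx_sym.
rewrite /C_mx -/(Q xi) -/(Q eta).
have : \tr (xi^T *m Q z *m eta) =
    \tr (J *m X^T *m sym (A *m S X *m sym (xi *m eta^T) *m A) *m z).
  rewrite mxtrace_mulC mulmxA mxtrace_mulC mxtrace_sym_adj.
  have -> : sym (eta *m xi^T) = sym (xi *m eta^T).
    by rewrite /sym !trmx_mul !trmxK addrC.
  set Sigma := sym (xi *m eta^T).
  have -> : A *m sym (X *m J *m z^T) *m A *m S X *m Sigma =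
     A *m (sym (X *m J *m z^T) *m (A *m S X *m Sigma)) by rewrite !mulmxA.
  rewrite mxtrace_mulC -[X in \tr X = _]mulmxA mxtrace_sym_adj.
  have := trmx_sym (A *m S X *m Sigma *m A).
  move: (sym (A *m S X *m Sigma *m A)) => Y YT.
  rewrite -[LHS]mxtrace_tr !trmx_mul !trmxK YT J_sym.
  by rewrite mulmxA [LHS]mxtrace_mulC !mulmxA.
move=> ->; move: (Q xi) (QT xi) (Q eta) (QT eta) => Qx QxT Qe QeT.
have := trmx_sym (A *m S X *m sym (xi *m eta^T) *m A).
move: (sym (A *m S X *m sym (xi *m eta^T) *m A)) => Y YT.
rewrite trmxB trmxD !trmx_mul QxT QeT YT J_sym mulmxBl mulmxDl raddfB /= mxtraceD.
by rewrite !mulmxA.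
Qed.

(** [Pi_mx] kills the first summand of [D_mx]; the skew parts in the others arise
    because the two terms of each derivative enter with opposite signs once the
    third trace is rotated. *)
Lemma christoffel_Pi X xi eta z : M X ->
  let Q v := Pi X *m v *m Mi X *m X^T + X *m Mi X *m v^T *m Pi X in
  \tr (eta^T *m Q xi *m z) + \tr (xi^T *m Q eta *m z) - \tr (xi^T *m Q z *m eta) =
  2 * \tr ((Pi X *m D_mx X xi eta + X *m Mi X *m sym (xi^T *m Pi X *m eta))^T *m z).
Proof.
move=> XJ Q; rewrite {}/Q.
have -> : Pi X *m D_mx X xi eta =
    Pi X *m (xi *m Defs.skew (Mi X *m X^T *m eta) + eta *m Defs.skew (Mi X *m X^T *m xi)).
  by rewrite /D_mx -addrA (mulmxDr (Pi X) (X *m Mi X *m _)) (mulmxA (Pi X) (X *m Mi X)) (mulmxA (Pi X) X) (Pi_iSt J_sqr XJ) !mul0mx add0r.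
have MiT := trmx_gram_inv X; have PiT := trmx_Pi X.
have h1 : \tr (xi^T *m Pi X *m z *m Mi X *m X^T *m eta) = \tr (Mi X *m X^T *m eta *m xi^T *m Pi X *m z).
  rewrite [LHS](_ : _ = \tr (xi^T *m Pi X *m z *m (Mi X *m X^T *m eta))); last by rewrite !mulmxA.
  by rewrite mxtrace_mulC !mulmxA.
have h2 : \tr (xi^T *m X *m Mi X *m z^T *m Pi X *m eta) = \tr (Mi X *m X^T *m xi *m eta^T *m Pi X *m z).
  rewrite [RHS](_ : _ = \tr (Mi X *m X^T *m xi *m (eta^T *m Pi X *m z))); last by rewrite !mulmxA.
  by rewrite [RHS]mxtrace_mulC -[RHS]mxtrace_tr !trmx_mul !trmxK MiT PiT !mulmxA.
rewrite /Defs.skew /sym.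
move: (Pi X) (Mi X) MiT PiT h1 h2 => P N NT PT h1 h2.
rewrite !(mulmxBl, mulmxBr, mulmxDl, mulmxDr, trmxB, trmxD, trmx_mul, trmxZ, trmxK, NT, PT).
rewrite -!(scalemxAl, scalemxAr) !(mulmxBl, mulmxBr, mulmxDl, mulmxDr, trmxB, trmxD, trmx_mul, trmxZ, trmxK, NT, PT).
rewrite !mulmxA !(mulmxBl, mulmxDl, raddfB, raddfN, mxtraceD, mxtraceZ) /= h1 h2; tr_lin.
Qed.

End Christoffel.

(** * The Hessian formulas *)

(** The derivatives of both metrics are differences of a common first part and a
    second part, and the Koszul terms are linear in them. *)
Lemma mxtrace_christoffelB (R : realType) n p (a b c d : R) (xi eta z E Q : 'M[R]_(n, p))
    (Exi Eeta Ez Qxi Qeta Qz : 'M[R]_n) :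
  b * c = 2 * d ->
  \tr (eta^T *m Exi *m z) + \tr (xi^T *m Eeta *m z) - \tr (xi^T *m Ez *m eta) =
    2 * \tr (E^T *m z) ->
  \tr (eta^T *m Qxi *m z) + \tr (xi^T *m Qeta *m z) - \tr (xi^T *m Qz *m eta) =
    c * \tr (Q^T *m z) ->
  2 * \tr ((a *: E - d *: Q)^T *m z) =
    \tr (eta^T *m (a *: Exi - b *: Qxi) *m z)
    + \tr (xi^T *m (a *: Eeta - b *: Qeta) *m z)
    - \tr (xi^T *m (a *: Ez - b *: Qz) *m eta).
Proof.
move=> bcd hE hQ.
rewrite trmxB !trmxZ !(mulmxBr, mulmxBl) -!(scalemxAl, scalemxAr) !raddfB /= !mxtraceZ.
move: (congr1 ( *%R a) hE) (congr1 ( *%R b) hQ); rewrite [in X in _ -> X -> _]mulrA bcd /=.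
tr_lin.
Qed.

Section Main.
Context (R : realType) (n p : nat) (A : 'M[R]_n) (J : 'M[R]_p) (rho : R).
Hypotheses (A_sym : A^T = A) (A_unit : A \in unitmx).
Hypotheses (J_sym : J^T = J) (J_sqr : J *m J = 1%:M).
Hypothesis (rho_gt0 : 0 < rho).
Local Notation V := 'M[R]_(n, p).
Local Notation M := (iSt A J : set V).
Local Notation T := (@tangent R n p A).
Implicit Types X u v xi eta z : V.

Local Notation S := (S_mx A J).
Local Notation Pi := (@Pi_mx R n p).
Local Notation Mi := (@gram_inv R n p).

(** The two factors are skew-symmetric, so the product in reverse order is the
    transpose. *)
Lemma iSt_B X xi eta : T X xi -> T X eta ->
  X^T *m A *m B_mx A X xi eta = 2 *: sym (Omega_mx A X xi *m Omega_mx A X eta).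
Proof.
move=> /(tangentP A_sym) Txi /(tangentP A_sym) Teta.
rewrite /sym scalerA divff ?pnatr_eq0// scale1r trmx_mul Txi Teta.
by rewrite mulNmx mulmxN opprK /Omega_mx /B_mx mulmxDr !mulmxA.
Qed.

(** This is how the terms of the Hessian outside the projection are seen to be
    tangent: they start with [invmx A] times a matrix annihilated by [X^T]. *)
Lemma tangent_Omega0 X (Y : V) : X^T *m A *m Y = 0 -> T X Y.
Proof. by move=> XY; apply/(tangentP A_sym); rewrite /Skew /= XY trmx0 oppr0. Qed.

(** The Christoffel symbol of the ambient metric [G1] on tangent vectors, with its
    index lowered: [G1 A J rho X] is still to be inverted. *)
Definition lower_christoffel1 X xi eta : V :=
  rho^-1 *: (A *m (X *m sym (xi^T *m A *m eta) + B_mx A X xi eta))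
  - 2 *: C_mx A J X xi eta.

Lemma lower_christoffel1P X xi eta z : T X xi -> T X eta ->
  2 * \tr ((lower_christoffel1 X xi eta)^T *m z) =
    \tr (eta^T *m 'D_xi (G1 A J rho) X *m z)
    + \tr (xi^T *m 'D_eta (G1 A J rho) X *m z)
    - \tr (xi^T *m 'D_z (G1 A J rho) X *m eta).
Proof.
move=> Txi Teta; have dG1 := is_diff_G1 rho A_sym J_sym X.
rewrite !(is_diff_derive _ dG1).
have := christoffel_S A J_sym X xi eta z; rewrite -[X in _ = X -> _]mul1r => hS.
(* The derivative of [G1] contains minus four times the matrices of
   [christoffel_S], and [C_mx] enters with half of that coefficient. *)
have e : 4 * 1 = 2 * 2 :> R by rewrite mulr1 -natrM.
exact: (mxtrace_christoffelB rho^-1 e (christoffel_AXXA A_sym z Txi Teta) hS).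
Qed.

Lemma invmx_G1_christoffel X xi eta : M X -> T X xi -> T X eta ->
  invmx (G1 A J rho X) *m lower_christoffel1 X xi eta =
  X *m J *m sym (xi^T *m A *m eta)
  + invmx A *m Pi X *m (rho^-1 *: B_mx A X xi eta - 2 *: (invmx A *m C_mx A J X xi eta))
  + 2 *: (X *m (- (rho *: (X^T *m C_mx A J X xi eta))
                + sym (Omega_mx A X xi *m Omega_mx A X eta))).
Proof.
move=> XJ Txi Teta; rewrite (G1_inv A_unit J_sqr rho_gt0 XJ).2 /lower_christoffel1.
have rho0 : rho != 0 by rewrite gt_eqF.
have XB := iSt_B Txi Teta.
move: (B_mx A X xi eta) (C_mx A J X xi eta) (sym (Omega_mx A X xi *m Omega_mx A X eta)) XB => B C Y XB.
move: (sym (xi^T *m A *m eta)) => s.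
have h1 : X *m X^T *m (A *m (X *m s + B)) =
    X *m J *m s + 2 *: (X *m Y).
  rewrite !mulmxDr -!mulmxA (mulmxA A X s) (mulmxA X^T) (mulmxA X^T A X) XJ.
  by rewrite (mulmxA X^T A B) XB scalemxAr.
have h2 : invmx A *m Pi X *m invmx A *m (A *m (X *m s + B)) = invmx A *m Pi X *m B.
  by rewrite -!mulmxA mulKmx// (mulmxDr (Pi X)) (mulmxA (Pi X)) (Pi_iSt J_sqr XJ) mul0mx add0r.
rewrite mulmxDl (mulmxBr (rho *: _)) (mulmxBr (invmx A *m Pi X *m invmx A)).
rewrite -!scalemxAl -!scalemxAr h1 h2 scalerA mulfV// scale1r.
rewrite (mulmxBr (invmx A *m Pi X)) (mulmxDr X) mulmxN -!scalemxAr !mulmxA.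
mx_abel.
Qed.

(** The analogue of [lower_christoffel1] for [G2]. *)
Definition lower_christoffel2 X xi eta : V :=
  rho^-1 *: (A *m (X *m sym (xi^T *m A *m eta) + B_mx A X xi eta))
  - (Pi X *m D_mx X xi eta + X *m Mi X *m sym (xi^T *m Pi X *m eta)).

Lemma lower_christoffel2P X xi eta z : M X -> T X xi -> T X eta ->
  2 * \tr ((lower_christoffel2 X xi eta)^T *m z) =
    \tr (eta^T *m 'D_xi (G2 A rho) X *m z)
    + \tr (xi^T *m 'D_eta (G2 A rho) X *m z)
    - \tr (xi^T *m 'D_z (G2 A rho) X *m eta).
Proof.
move=> XJ Txi Teta; have dG2 := is_diff_G2 rho J_sqr XJ.
rewrite !(is_diff_derive _ dG2).
have e : 1 * 2 = 2 * 1 :> R by rewrite mulrC.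
have := mxtrace_christoffelB rho^-1 e (christoffel_AXXA A_sym z Txi Teta)
  (christoffel_Pi J_sqr xi eta z XJ).
rewrite !scale1r; exact.
Qed.

Lemma invmx_G2_christoffel X xi eta : M X -> T X xi -> T X eta ->
  invmx (G2 A rho X) *m lower_christoffel2 X xi eta =
  X *m J *m sym (xi^T *m A *m eta)
  + invmx A *m S X *m (rho^-1 *: (S X *m B_mx A X xi eta) - D_mx X xi eta
      + A *m X *m J *m sym (xi^T *m Pi X *m eta))
  + X *m (- (rho *: sym (xi^T *m Pi X *m eta))
          + 2 *: sym (Omega_mx A X xi *m Omega_mx A X eta)).
Proof.
move=> XJ Txi Teta; rewrite (G2_inv A_sym A_unit J_sym J_sqr rho_gt0 XJ).2 /lower_christoffel2.
have rho0 : rho != 0 by rewrite gt_eqF.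
have XB := iSt_B Txi Teta.
move: (B_mx A X xi eta) (D_mx X xi eta) (sym (Omega_mx A X xi *m Omega_mx A X eta)) XB => B D Y XB.
move: (sym (xi^T *m A *m eta)) (sym (xi^T *m Pi X *m eta)) => s t.
have SX := S_iSt J_sqr XJ.
have h1 : X *m X^T *m (A *m (X *m s + B)) =
    X *m J *m s + 2 *: (X *m Y).
  rewrite !mulmxDr -!mulmxA (mulmxA A X s) (mulmxA X^T) (mulmxA X^T A X) XJ.
  by rewrite (mulmxA X^T A B) XB scalemxAr.
have h2 : invmx A *m S X *m S X *m invmx A *m (A *m (X *m s + B)) = invmx A *m S X *m (S X *m B).
  by rewrite -!mulmxA mulKmx// (mulmxDr (S X)) (mulmxA (S X) X) SX mul0mx add0r.
(* The correction term enters only through these two products. *)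
have XL : X^T *m (Pi X *m D + X *m Mi X *m t) = t.
  rewrite mulmxDr -!mulmxA (mulmxA X^T (Pi X)) (iSt_Pi J_sqr XJ) mul0mx add0r.
  by rewrite (mulmxA X^T X) mulKVmx//; exact: (unit_gram J_sqr XJ).
have SL : S X *m (Pi X *m D + X *m Mi X *m t) = S X *m D.
  rewrite (mulmxDr (S X)) (mulmxA (S X) (Pi X)) (S_Pi J_sqr XJ).
  by rewrite -mulmxA (mulmxA (S X)) SX mul0mx addr0.
have h3 : X *m X^T *m (Pi X *m D + X *m Mi X *m t) = X *m t by rewrite -mulmxA XL.
have h4 : invmx A *m S X *m S X *m invmx A *m (Pi X *m D + X *m Mi X *m t) =
    invmx A *m S X *m (D - A *m X *m J *m t).
  rewrite -(mulmxA _ (S X) (invmx A)) (S_invA _ A_unit) -(mulmxA (invmx A *m S X)).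
  rewrite (mulmxBl 1%:M) mul1mx -(mulmxA _ X^T) XL.
  by rewrite -!(mulmxA (invmx A)) (mulmxBr (S X)) SL -(mulmxBr (S X)).
move: (Pi X *m D + X *m Mi X *m t) h3 h4 => L h3 h4.
rewrite mulmxDl (mulmxBr (rho *: _)) (mulmxBr (invmx A *m S X *m S X *m invmx A)).
rewrite -!scalemxAl -!scalemxAr h1 h2 h3 h4 scalerA mulfV// scale1r.
rewrite (mulmxBr (invmx A *m S X) D) (mulmxDr (invmx A *m S X)) (mulmxBr (invmx A *m S X)).
rewrite (mulmxDr X) mulmxN -!scalemxAr.
mx_abel.
Qed.

End Main.

Theorem proposition4p2 (R : realType) (n p : nat)
    (p_gt0 : (0 < p)%N) (le_pn : (p <= n)%N)
    (A : 'M[R]_n) (A_sym : A^T = A) (A_unit : A \in unitmx)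
    (J : 'M[R]_p) (J_sym : J^T = J) (J_sqr : J *m J = 1%:M)
    (J_pos : (npos_eig J <= npos_eig A)%N)
    (J_neg : (nneg_eig J <= nneg_eig A)%N)
    (rho : R) (rho_gt0 : 0 < rho)
    (f fbar : 'M[R]_(n, p) -> R)
    (f_smooth : smooth_map (iSt A J) f)
    (fbar_smooth : smooth_on (ambient p A) fbar)
    (fbar_ext : forall Y, iSt A J Y -> fbar Y = f Y)
    (nabla1 nabla2 : 'M[R]_(n, p) -> 'M[R]_(n, p) ->
       ('M[R]_(n, p) -> 'M[R]_(n, p)) -> 'M[R]_(n, p))
    (nabla1_lc : is_levi_civita (iSt A J) (tangent A)
       (metric (G1 A J rho)) nabla1)
    (nabla2_lc : is_levi_civita (iSt A J) (tangent A)
       (metric (G2 A rho)) nabla2)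
    (X xi : 'M[R]_(n, p)) (X_iSt : iSt A J X) (xi_tangent : tangent A X xi) :
  let g1 := metric (G1 A J rho) in
  let g2 := metric (G2 A rho) in
  let S := S_mx A J X in
  let P := proj_tan A J X in
  let Om := Omega_mx A X in
  let B := B_mx A X xi in
  let C := C_mx A J X xi in
  let D := D_mx X xi in
  let G1i := invmx (G1 A J rho X) in
  let G2i := invmx (G2 A rho X) in
  let gE := egrad fbar X in
  let HE := ehess fbar X xi in
  let DG1 := 'D_xi (G1 A J rho) X in
  let DG2 := 'D_xi (G2 A rho) X in
  let eta1 := rgrad (iSt A J) (tangent A) g1 f X in
  let eta2 := rgrad (iSt A J) (tangent A) g2 f X in
  (forall zeta, tangent A X zeta -> Skew (Om zeta)) /\
  [/\ is_orth_proj (tangent A X) (g1 X) P,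
      eta1 = G1i *m gE - X *m J *m sym (X^T *m A *m G1i *m gE) &
      rhess (iSt A J) (tangent A) g1 nabla1 f X xi =
        invmx A *m Pi_mx X *m (rho^-1 *: B eta1 - 2 *: (invmx A *m C eta1))
        + P (2 *: (X *m (- (rho *: (X^T *m C eta1))
                         + sym (Om xi *m Om eta1)))
             - G1i *m DG1 *m G1i *m gE
             + G1i *m HE
             - rho *: (xi *m J *m sym (J *m X^T *m gE)))] /\
  [/\ is_orth_proj (tangent A X) (g2 X) P,
      eta2 = G2i *m gE - X *m J *m sym (X^T *m A *m G2i *m gE) &
      rhess (iSt A J) (tangent A) g2 nabla2 f X xi =
        invmx A *m S *m (rho^-1 *: (S *m B eta2) - D eta2
                         + A *m X *m J *m sym (xi^T *m Pi_mx X *m eta2))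
        + P (X *m (- (rho *: sym (xi^T *m Pi_mx X *m eta2))
                   + 2 *: sym (Om xi *m Om eta2))
             - G2i *m DG2 *m G2i *m gE
             + G2i *m HE
             - rho *: (xi *m J *m sym (J *m X^T *m gE)))].
Proof.
move=> g1 g2 S P Om B C D G1i G2i gE HE DG1 DG2 eta1 eta2.
have G1s := G1_sym rho A_sym J_sym.
have G1u Y (YJ : iSt A J Y) := (G1_inv A_unit J_sqr rho_gt0 YJ).1.
have G1J Y := @G1_iSt R n p A J rho J_sqr Y.
have G1d Y v := @G1_def R n p A J rho A_sym A_unit J_sym rho_gt0 Y v.
have G1c := smooth_G1 A J rho (@open_ambient R n p A).
have G2s Y := @G2_sym R n p A rho A_sym Y.
have G2u Y (YJ : iSt A J Y) := (G2_inv A_sym A_unit J_sym J_sqr rho_gt0 YJ).1.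
have G2J Y := @G2_iSt R n p A J rho J_sqr Y.
have G2d Y v := @G2_def R n p A J rho A_sym J_sqr rho_gt0 Y v.
have G2c := smooth_G2 p A rho.
have e1 : eta1 = G1i *m gE - X *m J *m sym (X^T *m A *m G1i *m gE).
  rewrite /eta1 (rgradE A_sym J_sym J_sqr G1s G1u G1J G1d fbar_smooth fbar_ext X_iSt).
  by rewrite /grad_ext /proj_tan mulmxA.
have e2 : eta2 = G2i *m gE - X *m J *m sym (X^T *m A *m G2i *m gE).
  rewrite /eta2 (rgradE A_sym J_sym J_sqr G2s G2u G2J G2d fbar_smooth fbar_ext X_iSt).
  by rewrite /grad_ext /proj_tan mulmxA.
have T1 : tangent A X eta1.
  rewrite /eta1 (rgradE A_sym J_sym J_sqr G1s G1u G1J G1d fbar_smooth fbar_ext X_iSt).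
  exact: tangent_proj.
have T2 : tangent A X eta2.
  rewrite /eta2 (rgradE A_sym J_sym J_sqr G2s G2u G2J G2d fbar_smooth fbar_ext X_iSt).
  exact: tangent_proj.
split; first by move=> zeta /(tangentP A_sym).
split; split=> //.
- exact: (orth_proj_tan A_sym J_sym J_sqr G1s G1J X_iSt).
- have k1 z (_ : tangent A X z) := lower_christoffel1P rho A_sym J_sym z xi_tangent T1.
  apply: (rhess_decomp A_sym J_sym J_sqr rho_gt0 G1s G1c G1u G1J G1d fbar_smooth fbar_ext
    nabla1_lc X_iSt xi_tangent k1 (invmx_G1_christoffel A_sym A_unit J_sqr rho_gt0 X_iSt xi_tangent T1)).
    exact: trmx_sym.
  apply: (tangent_Omega0 A_sym).
  by rewrite !mulmxA mulmxK// (iSt_Pi J_sqr X_iSt) mul0mx.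
- exact: (orth_proj_tan A_sym J_sym J_sqr G2s G2J X_iSt).
- have k2 z (_ : tangent A X z) := lower_christoffel2P rho A_sym J_sqr z X_iSt xi_tangent T2.
  apply: (rhess_decomp A_sym J_sym J_sqr rho_gt0 G2s G2c G2u G2J G2d fbar_smooth fbar_ext
    nabla2_lc X_iSt xi_tangent k2 (invmx_G2_christoffel A_sym A_unit J_sym J_sqr rho_gt0 X_iSt xi_tangent T2)).
    exact: trmx_sym.
  apply: (tangent_Omega0 A_sym).
  by rewrite !mulmxA mulmxK// (iSt_S A_sym J_sym J_sqr X_iSt) mul0mx.
Qed.
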